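(* Let $F^2(x,y)=B(x,y)J^2(x,y)$ be the pseudo-Finsleroid metric function (defined in the context) built from $(a_{ij},b_i,g)$ with $a^{ij}b_ib_j=-c^2$, $0<c\le 1$. At every $x\in M$ and every $y\in T_xM$ in the time-like sector ($\epsilon=1$) or in the space-like sector ($\epsilon=-1$) with $\nu\neq0$, the spray coefficients $G^i=\gamma^i{}_{nm}y^ny^m$ of $F$ are given by $$G^i=-\epsilon\frac{g}{\nu}\Bigl(y^jy^h\nabla_jb_h-g\,q\,b^jf_j\Bigr)v^i+g\,q\,f^i+E^i+a^i{}_{nm}y^ny^m,$$ where $v^i=y^i+b\,b^i$, $\nu=q-\epsilon(1-c^2)g\,b$, $f_{mn}=\nabla_mb_n-\nabla_nb_m=\frac{\partial b_n}{\partial x^m}-\frac{\partial b_m}{\partial x^n}$, $f^i{}_n=a^{ik}f_{kn}$, $f^i=f^i{}_ny^n$, $f_j=a_{ji}f^i=f_{jn}y^n$, and $$E^i=g^{ih}\frac{\partial y_h}{\partial g}\,(yg)-\frac12\bar M F^2 g_hg^{ih},\qquad g_h=\frac{\partial g}{\partial x^h},\qquad (yg)=y^hg_h,$$ with $\bar M$ defined by $\dfrac{\partial F^2}{\partial g}=\bar M F^2$.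
   Context: Let $M$ be an $N$-dimensional smooth manifold with a pseudo-Riemannian metric tensor $a_{ij}(x)$ of signature $(+,-,\dots,-)$ and inverse $a^{ij}$, a 1-form $b_i(x)$ with $a^{ij}b_ib_j=-c(x)^2$, $0<c(x)\le1$, and a scalar field $g(x)$ (all smooth). Put $b^i=a^{ij}b_j$. $\nabla$ is the Levi-Civita covariant derivative of $a_{ij}$ and $a^i{}_{nm}$ are its Christoffel symbols. For $y\in T_xM$ put $$b=b_i(x)y^i,\quad r_{ij}=a_{ij}+b_ib_j,\quad \gamma=r_{ij}y^iy^j,\quad q=\sqrt{|\gamma|},\quad B=\gamma-g\,b\,q-b^2 .$$ Time-like sector ($\epsilon=1$, any real $g$): the $y$ with $\gamma>0$ and $B>0$. There $h=\sqrt{1+g^2/4}$, $G=g/h$, $g_\pm=-\frac12g\pm h$, $B=(b-g_-q)(g_+q-b)$ and $J=\left(\frac{b-g_-q}{g_+q-b}\right)^{-G/4}$. Space-like sector ($\epsilon=-1$, $-2<g<2$): the $y$ with $\gamma<0$ (so $B=-(q^2+gbq+b^2)<0$). There $h=\sqrt{1-g^2/4}$, $G=g/h$, $L=q+\frac g2 b$, $J=e^{-\frac12 G f}$ with $f=-\arctan\frac G2+\arctan\frac{L}{hb}$ if $b<0$, $f=-\pi-\arctan\frac G2+\arctan\frac{L}{hb}$ if $b>0$ and, by continuity, $f=-\frac\pi2-\arctan\frac G2$ if $b=0$. In both sectors $F^2=BJ^2$, $y_i=\frac12\frac{\partial F^2}{\partial y^i}$, $g_{ij}=\frac12\frac{\partial^2F^2}{\partial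 y^i\partial y^j}$, $(g^{ij})$ is the inverse matrix of $(g_{ij})$. The Finslerian Christoffel symbols are $\gamma^i{}_{nm}=\frac12g^{ik}\bigl(\frac{\partial g_{kn}}{\partial x^m}+\frac{\partial g_{km}}{\partial x^n}-\frac{\partial g_{nm}}{\partial x^k}\bigr)$ (partial derivatives in $x$ at fixed $y$). The operator $\partial/\partial g$ denotes differentiation with respect to the parameter $g$ with $y^i,b_i,a_{ij}$ held fixed (the quantities $h$, $G$, $g_\pm$ being functions of $g$). *)

(* Defs.v *)
From HB Require Import structures.
From mathcomp Require Import all_boot all_order all_algebra.
From mathcomp Require Import all_classical all_reals all_analysis.

Set Implicit Arguments.
Unset Strict Implicit.
Unset Printing Implicit Defensive.

Import Order.TTheory GRing.Theory Num.Theory.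
Import numFieldNormedType.Exports.

Local Open Scope classical_set_scope.
Local Open Scope ring_scope.

(* Vectors and covectors are both rows of components: [y 0 i] stands for
   y^i or y_i according to the role of [y]. *)

Section Calculus.
Context {R : realType} {n : nat}.

Definition partial (i : 'I_n) (f : 'rV[R]_n -> R) (x : 'rV[R]_n) : R :=
  'D_(delta_mx 0 i) f x.

Fixpoint Ck (k : nat) (U : set 'rV[R]_n) (f : 'rV[R]_n -> R) : Prop :=
  (forall x, U x -> {for x, continuous f}) /\
  (if k is k'.+1 then
     forall i, (forall x, U x -> derivable f x (delta_mx 0 i)) /\
               Ck k' U (partial i f)
   else True).

Definition smooth_on (U : set 'rV[R]_n) (f : 'rV[R]_n -> R) : Prop :=
  forall k, Ck k U f.

(* [jacobian f x i j] is the derivative of the j-th component of f with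
   respect to x^i; with this convention covectors pull back by right
   multiplication by the transpose. *)
Definition jacobian (f : 'rV[R]_n -> 'rV[R]_n) (x : 'rV[R]_n) : 'M[R]_n :=
  \matrix_(i, j) partial i (fun z => f z 0 j) x.

End Calculus.

Record chart (R : realType) (n : nat) (T : topologicalType) := Chart {
  cdom : set T;
  cmap : T -> 'rV[R]_n;
  cinv : 'rV[R]_n -> T;
  cdom_open : open cdom;
  crange_open : open (cmap @` cdom);
  cmapK : forall p, cdom p -> cinv (cmap p) = p;
  cmap_continuous : {within cdom, continuous cmap};
  cinv_continuous : {within cmap @` cdom, continuous cinv}
}.

Section Charts.
Context {R : realType} {n : nat} {T : topologicalType}.
Implicit Types u v : chart R n T.

Definition crange u : set 'rV[R]_n := cmap u @` cdom u.

Definition overlap u v : set 'rV[R]_n := cmap u @` (cdom u `&` cdom v).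

Definition transition u v : 'rV[R]_n -> 'rV[R]_n := cmap v \o cinv u.

End Charts.

(* The atlas need not be maximal. *)
Record smoothManifold (R : realType) (n : nat) := SmoothManifold {
  carrier :> topologicalType;
  atlas : set (chart R n carrier);
  carrier_hausdorff : hausdorff_space carrier;
  carrier_second_countable : @second_countable carrier;
  atlas_cover : forall p : carrier, exists2 u, atlas u & cdom u p;
  atlas_compat : forall u v, atlas u -> atlas v -> forall j,
    smooth_on (overlap u v) (fun x => transition u v x 0 j)
}.
Arguments atlas {R n} _ _.

Definition smooth_scalar (R : realType) (n : nat) (M : smoothManifold R n)
    (f : M -> R) : Prop :=
  forall u, atlas M u -> smooth_on (crange u) (f \o cinv u).

(* Tensor fields are given by their components in each chart, as functions of
   the coordinates, subject to the transformation law. *)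
Record oneForm (R : realType) (n : nat) (M : smoothManifold R n) := OneForm {
  oneForm_comp :> chart R n M -> 'rV[R]_n -> 'rV[R]_n;
  oneForm_law : forall u v, atlas M u -> atlas M v ->
    forall x, overlap u v x ->
    oneForm_comp u x =
      oneForm_comp v (transition u v x) *m (jacobian (transition u v) x)^T;
  oneForm_smooth : forall u, atlas M u -> forall i,
    smooth_on (crange u) (fun x => oneForm_comp u x 0 i)
}.

(* Symmetric with signature (+,-,...,-). *)
Definition lorentzian (R : realType) (n : nat) (A : 'M[R]_n) : Prop :=
  A^T = A /\
  exists2 P : 'M[R]_n, P \in unitmx &
    P *m A *m P^T =
      diag_mx (\row_i (if val i == 0%N then 1 else -1)).

Record lorentzMetric (R : realType) (n : nat) (M : smoothManifold R n) :=
  LorentzMetric {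
  metric_comp :> chart R n M -> 'rV[R]_n -> 'M[R]_n;
  metric_law : forall u v, atlas M u -> atlas M v ->
    forall x, overlap u v x ->
    metric_comp u x =
      jacobian (transition u v) x *m metric_comp v (transition u v x)
        *m (jacobian (transition u v) x)^T;
  metric_smooth : forall u, atlas M u -> forall i j,
    smooth_on (crange u) (fun x => metric_comp u x i j);
  metric_lorentzian : forall u, atlas M u ->
    forall x, crange u x -> lorentzian (metric_comp u x)
}.

Inductive sector := TimeLike | SpaceLike.

(* Quantities at one point, in terms of the components of the metric [A], of
   the 1-form [be], of the parameter [g] and of the tangent vector [y]. *)
Section Pointwise.
Context {R : realType} {n : nat}.
Implicit Types (s : sector) (A : 'M[R]_n) (be y : 'rV[R]_n) (g : R).

Definition eps s : R := if s is TimeLike then 1 else -1.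

Definition raise A (w : 'I_n -> R) (i : 'I_n) : R :=
  \sum_j invmx A i j * w j.

Definition b_of be y : R := \sum_i be 0 i * y 0 i.

Definition gamma_of A be y : R :=
  \sum_i \sum_j (A i j + be 0 i * be 0 j) * y 0 i * y 0 j.

Definition q_of A be y : R := Num.sqrt `|gamma_of A be y|.

Definition B_of A be g y : R :=
  gamma_of A be y - g * b_of be y * q_of A be y - b_of be y ^+ 2.

Definition in_sector s A be g y : Prop :=
  match s with
  | TimeLike => 0 < gamma_of A be y /\ 0 < B_of A be g y
  | SpaceLike => gamma_of A be y < 0 /\ -2 < g < 2
  end.

Definition h_of s g : R := Num.sqrt (1 + eps s * (g ^+ 2 / 4)).

Definition G_of s g : R := g / h_of s g.

Definition gplus g : R := - (g / 2) + h_of TimeLike g.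

Definition gminus g : R := - (g / 2) - h_of TimeLike g.

Definition f_of A be g y : R :=
  let b := b_of be y in
  let L := q_of A be y + g / 2 * b in
  let h := h_of SpaceLike g in
  let G := G_of SpaceLike g in
  if b < 0 then - atan (G / 2) + atan (L / (h * b))
  else if 0 < b then - pi - atan (G / 2) + atan (L / (h * b))
  else - (pi / 2) - atan (G / 2).

Definition J_of s A be g y : R :=
  match s with
  | TimeLike =>
      let b := b_of be y in
      let q := q_of A be y in
      ((b - gminus g * q) / (gplus g * q - b)) `^ (- (G_of TimeLike g / 4))
  | SpaceLike => expR (- (G_of SpaceLike g / 2 * f_of A be g y))
  end.

Definition F2 s A be g y : R := B_of A be g y * J_of s A be g y ^+ 2.

Definition y_low s A be g y (i : 'I_n) : R :=
  2^-1 * partial i (F2 s A be g) y.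

Definition finsler_metric s A be g y : 'M[R]_n :=
  \matrix_(i, j) (2^-1 * partial i (partial j (F2 s A be g)) y).

Definition dg_y_low s A be g y (i : 'I_n) : R :=
  derive1 (fun t : R => y_low s A be t y i) g.

(* F^2 does not vanish on either sector, so this is the only M with
   dF^2/dg = M F^2. *)
Definition Mbar s A be g y : R :=
  derive1 (fun t : R => F2 s A be t y) g / F2 s A be g y.

End Pointwise.
Arguments eps {R} s.

(* Quantities in a coordinate system, where [a], [be] and [g] are the component
   functions of the metric, of the 1-form and of the scalar field. *)
Section Coordinates.
Context {R : realType} {n : nat}.
Implicit Types (s : sector) (a : 'rV[R]_n -> 'M[R]_n)
  (be : 'rV[R]_n -> 'rV[R]_n) (g : 'rV[R]_n -> R) (x y : 'rV[R]_n)
  (i j k m l : 'I_n).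

Definition christoffel a x i l m : R :=
  2^-1 * \sum_k invmx (a x) i k *
    (partial m (fun z => a z k l) x + partial l (fun z => a z k m) x
     - partial k (fun z => a z l m) x).

Definition christoffel_quad a x y i : R :=
  \sum_l \sum_m christoffel a x i l m * y 0 l * y 0 m.

Definition spray s a be g x y i : R :=
  christoffel_quad (fun z => finsler_metric s (a z) (be z) (g z) y) x y i.

Definition nabla a be x j k : R :=
  partial j (fun z => be z 0 k) x
  - \sum_l christoffel a x l j k * be x 0 l.

Definition b_up a be x i : R := raise (a x) (fun j => be x 0 j) i.

Definition v_up a be x y i : R := y 0 i + b_of (be x) y * b_up a be x i.

Definition f_form a be x m l : R := nabla a be x m l - nabla a be x l m.

Definition f_mixed a be x i l : R := raise (a x) (fun k => f_form a be x k l) i.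

Definition f_up a be x y i : R := \sum_l f_mixed a be x i l * y 0 l.

Definition f_low a be x y j : R := \sum_i a x j i * f_up a be x y i.

Definition E_up s a be g x y i : R :=
  let yg := \sum_k y 0 k * partial k g x in
  let ginv := invmx (finsler_metric s (a x) (be x) (g x) y) in
  \sum_k ginv i k * dg_y_low s (a x) (be x) (g x) y k * yg
  - 2^-1 * Mbar s (a x) (be x) (g x) y * F2 s (a x) (be x) (g x) y
    * \sum_k partial k g x * ginv i k.

End Coordinates.

(* Main.v *)
Require Import Defs.
From mathcomp Require Import all_boot all_order all_algebra.
From mathcomp Require Import all_classical all_reals all_analysis.
From mathcomp Require Import ring lra.
Import Order.TTheory GRing.Theory Num.Theory.
Import numFieldNormedType.Exports.
Local Open Scope classical_set_scope.
Local Open Scope ring_scope.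

(* Along every curve dF^2 = J^2 (d gamma - 2 (b + g q) db) + (...) dg, with the
   same formula in both sectors.  Hence y_k = J^2 (a_kj y^j - g q b_k), and g_ij
   is J^2 a_ij plus a symmetric combination of v_i v_j, v_i b_j + b_i v_j and
   b_i b_j, where v_i = a_ij v^j.  By Euler's theorem
   g_ki G^i = y^m d_m y_k - (1/2) d_k F^2; the terms in the gradient of g
   are g_ki E^i, and the rest is matched with g_ki applied to the claimed vector by
   g_ki v^i = J^2 (nu / (q B)) ((gamma - b^2) v_k - g q gamma b_k).
   Finally g_ij is invertible because nu <> 0. *)

Set Implicit Arguments.
Unset Strict Implicit.
Unset Printing Implicit Defensive.

(** The factor $J$ is built so that, at fixed $g$, $d\ln J^2=(g/B)(b\,dq-q\,db)$ in both sectors,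
    although it is a power in one and the exponential of an angle in the other. The $dq$-part of
    $B\,d\ln J^2$ then cancels the one of $dB$, which is why $dF^2$ contains only $d\gamma$ and
    $db$. The delicate point is the space-like $J$, given by cases on the sign of $b$: its
    differentiability across $b=0$ needs a second expression of the angle. The $g$-derivative of
    $\ln J^2$ is transcendental. It is only named, as [Z]: the $x$-derivatives of $F^2$ and $y_k$
    through $g(x)$ and the two terms of $E^i$ contain the same [Z], so it cancels. Derivatives are
    taken twice, and the closed forms are valid only inside the sector and the chart. Each
    replacement of a definition by its closed form under a derivative is therefore justified along a
    short line through the point, and one computation in which $a$, $b$, $g$ and $y$ all vary
    supplies the derivatives in $y$, in the parameter $g$ and in $x$. *)

Section DirectionalDerivative.
Context {R : realType} {V : normedModType R}.
Implicit Types (f k : V -> R) (phi : R -> R) (x v : V) (df dk : R).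

(** Brings one-variable results (chain rule, locality, [expR], [atan], [ln]) to directional
    derivatives without requiring [f] to be differentiable in the full sense. *)
Lemma is_derive_lineP f x v df :
  is_derive x v f df <-> is_derive (0 : R) 1 (fun t : R => f (t *: v + x)) df.
Proof.
(* The two difference quotients are the same function of the increment, so the limits agree without
   any convergence assumption. *)
have E : 'D_v f x = 'D_1 (fun t : R => f (t *: v + x)) 0.
  rewrite /derive; set F := (X in lim (X @ _)); set K := (X in _ = lim (X @ _)).
  suff -> : F = K by [].
  by apply/funext => t; rewrite /F /K /= addr0 scale0r add0r [t%:A]mulr1.
split=> -[d <-].
  by split; [apply/(derivable1P f x v)|rewrite E].
by split; [apply/(derivable1P f x v)|rewrite E].
Qed.

Lemma is_derive_scalar_comp phi f x v a df :
  is_derive (f x) 1 phi a -> is_derive x v f df ->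
  is_derive x v (fun z => phi (f z)) (a * df).
Proof.
move=> dphi /is_derive_lineP df'; apply/is_derive_lineP.
have fx : (fun t : R => f (t *: v + x)) 0 = f x by rewrite scale0r add0r.
by rewrite -fx in dphi; exact: (is_derive1_comp dphi df').
Qed.

(** This rule and the following ones are stated for explicit [fun z => ...] bodies, so that
    [diff_step] can select them by the syntax of the function. *)
Lemma is_derive_fun_cst (a : R) x v : is_derive x v (fun=> a) 0.
Proof. exact: is_derive_cst. Qed.

Lemma is_derive_fun_add f k x v df dk :
  is_derive x v f df -> is_derive x v k dk ->
  is_derive x v (fun z => f z + k z) (df + dk).
Proof. exact: is_deriveD. Qed.

Lemma is_derive_fun_opp f x v df :
  is_derive x v f df -> is_derive x v (fun z => - f z) (- df).
Proof. exact: is_deriveN. Qed.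

Lemma is_derive_fun_mul f k x v df dk :
  is_derive x v f df -> is_derive x v k dk ->
  is_derive x v (fun z => f z * k z) (df * k x + f x * dk).
Proof.
move=> d1 d2; apply: (is_derive_eq (is_deriveM d1 d2)).
by rewrite addrC mulrC.
Qed.

Lemma is_derive_fun_sqr f x v df :
  is_derive x v f df -> is_derive x v (fun z => f z ^+ 2) (2 * f x * df).
Proof.
move=> d; apply: (is_derive_eq (is_derive_fun_mul d d)).
by rewrite mulrC -mulrDl; ring.
Qed.

Lemma is_derive_fun_inv f x v df : f x != 0 ->
  is_derive x v f df -> is_derive x v (fun z => (f z)^-1) (- df / f x ^+ 2).
Proof.
move=> f0 d.
have d1 := @is_deriveV R id (f x) 1 1 f0 (is_derive_id _ _).
by apply: (is_derive_eq (is_derive_scalar_comp d1 d)); rewrite /= scaler1; ring.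
Qed.

Lemma is_derive_fun_sum (I : finType) (F : I -> V -> R) (dF : I -> R) x v :
  (forall i, is_derive x v (F i) (dF i)) ->
  is_derive x v (fun z => \sum_i F i z) (\sum_i dF i).
Proof.
move=> d; rewrite -(big_enum _ _ _ dF).
have -> : (fun z => \sum_i F i z) = (fun z => \sum_(i <- enum I) F i z).
  by apply/funext => z; rewrite big_enum.
elim: (enum I) => [|i s IH].
  under eq_fun do rewrite big_nil.
  by rewrite big_nil; exact: is_derive_fun_cst.
under eq_fun do rewrite big_cons.
by rewrite big_cons; apply: is_derive_fun_add.
Qed.

Lemma is_derive_fun_sqrt f x v df : 0 < f x ->
  is_derive x v f df ->
  is_derive x v (fun z => Num.sqrt (f z)) (df / (2 * Num.sqrt (f x))).
Proof.
move=> f0 d; apply: (is_derive_eq (is_derive_scalar_comp (is_derive1_sqrt f0) d)).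
by rewrite mulrC.
Qed.

End DirectionalDerivative.

Section Curves.
Context {R : realType}.
Implicit Types (f : R -> R) (t df : R).

Lemma is_derive_continuous f t df : is_derive t 1 f df -> {for t, continuous f}.
Proof. by move=> [/derivable1_diffP/differentiable_continuous]. Qed.

Lemma is_derive_near_gt0 f t df : is_derive t 1 f df -> 0 < f t ->
  \forall z \near t, 0 < f z.
Proof. by move=> /is_derive_continuous c f0; apply: (cvgr_gt _ c). Qed.

Lemma is_derive_near_lt0 f t df : is_derive t 1 f df -> f t < 0 ->
  \forall z \near t, f z < 0.
Proof. by move=> /is_derive_continuous c f0; apply: (cvgr_lt _ c). Qed.

End Curves.

(** Hypotheses are tried before the structural rules, so a quantity whose derivative is already
    known is treated as an atom. Subtraction and division are read as sum with an opposite and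
    product with an inverse. The final [eassumption] closes the sign and nonvanishing side
    conditions. *)
Ltac diff_step :=
  match goal with
  | H : is_derive ?x ?v ?f _ |- is_derive ?x ?v ?f _ => exact H
  | |- is_derive _ _ _ _ =>
    lazymatch goal with
    | |- is_derive _ _ (fun=> ?c) _ => eapply is_derive_fun_cst
    | |- is_derive _ _ (fun z => @?f z + @?k z) _ => eapply is_derive_fun_add
    | |- is_derive _ _ (fun z => - @?f z) _ => eapply is_derive_fun_opp
    | |- is_derive _ _ (fun z => @?f z ^+ 2) _ => eapply is_derive_fun_sqr
    | |- is_derive _ _ (fun z => (@?f z)^-1) _ => eapply is_derive_fun_inv
    | |- is_derive _ _ (fun z => Num.sqrt (@?f z)) _ => eapply is_derive_fun_sqrt
    | |- is_derive _ _ (fun z => @?f z * @?k z) _ => eapply is_derive_fun_mul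
    | |- is_derive _ _ (fun z => atan (@?f z)) _ =>
        eapply (is_derive_scalar_comp (is_derive1_atan _))
    | |- is_derive _ _ (fun z => expR (@?f z)) _ =>
        eapply (is_derive_scalar_comp (is_derive_expR _))
    end
  | |- _ => eassumption
  end.
Ltac diff := repeat diff_step.

(* [notypeclasses] prevents the library's instances for [is_derive] from
   choosing the shape of the derivative. *)
Ltac diff_eq := notypeclasses refine (is_derive_eq _ _); [by diff|rewrite /=].

(** * The factor $J$ as a function of $q$, $b$ and $g$ *)

Section Indicatrix.
Context {R : realType}.
Implicit Types (s : sector) (q b g t : R).

(* [B], [f] and [J] as functions of [q], [b] and [g] alone. *)
Definition B_fun s q b g : R := eps s * q ^+ 2 - g * b * q - b ^+ 2.

Definition f_fun q b g : R :=
  let L := q + g / 2 * b in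
  let h := h_of SpaceLike g in
  let G := G_of SpaceLike g in
  if b < 0 then - atan (G / 2) + atan (L / (h * b))
  else if 0 < b then - pi - atan (G / 2) + atan (L / (h * b))
  else - (pi / 2) - atan (G / 2).

Definition J_fun s q b g : R :=
  match s with
  | TimeLike =>
      ((b - gminus g * q) / (gplus g * q - b)) `^ (- (G_of TimeLike g / 4))
  | SpaceLike => expR (- (G_of SpaceLike g / 2 * f_fun q b g))
  end.

(** The sector seen in the variables $(q,b,g)$. In the space-like case $q>0$ and $|g|<2$ already
    force $B<0$. *)
Definition admissible s q b g : Prop :=
  0 < q /\ match s with
           | TimeLike => 0 < B_fun s q b g
           | SpaceLike => -2 < g < 2
           end.

Lemma h_of_radicand_gt0 s q b g : admissible s q b g ->
  0 < 1 + eps s * (g ^+ 2 / 4).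
Proof.
case: s => -[q0] /= H; last by case/andP: H => *; nra.
by have := sqr_ge0 g; lra.
Qed.

Lemma h_of_sqr s q b g : admissible s q b g ->
  h_of s g ^+ 2 = 1 + eps s * (g ^+ 2 / 4).
Proof. by move=> /h_of_radicand_gt0 H; rewrite /h_of sqr_sqrtr // ltW. Qed.

Lemma h_of_gt0 s q b g : admissible s q b g -> 0 < h_of s g.
Proof. by move=> /h_of_radicand_gt0 H; rewrite /h_of sqrtr_gt0. Qed.

Lemma eps_sqr s : eps s ^+ 2 = 1 :> R.
Proof. by case: s => /=; ring. Qed.

Lemma B_fun_neq0 s q b g : admissible s q b g -> B_fun s q b g != 0.
Proof.
case: s => -[q0] /= H; first by rewrite gt_eqF.
case/andP: H => g1 g2; rewrite lt_eqF // /B_fun /=.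
(* Completing the square: $-B=(b+gq/2)^2+\frac14(4-g^2)q^2$. *)
have hq : 0 < (2 - g) * (2 + g) * q ^+ 2.
  by rewrite !mulr_gt0 ?exprn_gt0 //; lra.
by have := sqr_ge0 (b + g * q / 2); nra.
Qed.

Lemma B_time_factor q b g :
  (b - gminus g * q) * (gplus g * q - b) = B_fun TimeLike q b g.
Proof.
have h2 : h_of TimeLike g ^+ 2 = 1 + g ^+ 2 / 4.
  by rewrite /h_of /= mul1r sqr_sqrtr // addr_ge0 // divr_ge0 // sqr_ge0.
transitivity ((h_of TimeLike g ^+ 2 - g ^+ 2 / 4) * q ^+ 2 - g * b * q - b ^+ 2).
  by rewrite /gplus /gminus; field.
by rewrite h2 /B_fun /=; field.
Qed.

(** The two factors have product $B>0$ and sum $2hq>0$. *)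
Lemma time_factors_gt0 q b g : admissible TimeLike q b g ->
  0 < b - gminus g * q /\ 0 < gplus g * q - b.
Proof.
move=> adm; have [q0 B0] := adm; have h0 := h_of_gt0 adm.
rewrite -B_time_factor in B0.
have : 0 < (b - gminus g * q) + (gplus g * q - b).
  by rewrite /gplus /gminus; nra.
set X := b - _ in B0 *; set Y := gplus g * q - b in B0 * => XY.
by split; nra.
Qed.

Lemma J_fun_gt0 s q b g : admissible s q b g -> 0 < J_fun s q b g.
Proof.
case: s => adm /=; last exact: expR_gt0.
by have [X0 Y0] := time_factors_gt0 adm; rewrite powR_gt0 // divr_gt0.
Qed.

Lemma is_derive_h_of s (g : R -> R) t dg : 0 < 1 + eps s * (g t ^+ 2 / 4) ->
  is_derive t 1 g dg ->
  is_derive t 1 (fun z => h_of s (g z)) (eps s * g t * dg / (4 * h_of s (g t))).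
Proof.
move=> h0 d; rewrite /h_of.
have hn0 : Num.sqrt (1 + eps s * (g t ^+ 2 / 4)) != 0 by rewrite gt_eqF // sqrtr_gt0.
diff_eq.
by rewrite /=; field.
Qed.

(** The numerator $h^2-\epsilon g^2/4$ of $dG/dg$ equals 1. *)
Lemma is_derive_G_of s (g : R -> R) t dg : 0 < 1 + eps s * (g t ^+ 2 / 4) ->
  is_derive t 1 g dg ->
  is_derive t 1 (fun z => G_of s (g z)) (dg / h_of s (g t) ^+ 3).
Proof.
move=> h0 d; rewrite /G_of; have dh := is_derive_h_of h0 d.
have hn0 : h_of s (g t) != 0 by rewrite /h_of gt_eqF // sqrtr_gt0.
have h2 : h_of s (g t) ^+ 2 = 1 + eps s * (g t ^+ 2 / 4).
  by rewrite /h_of sqr_sqrtr // ltW.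
diff_eq.
transitivity (dg * (h_of s (g t) ^+ 2 - eps s * (g t ^+ 2 / 4)) / h_of s (g t) ^+ 3).
  by field.
by rewrite h2; congr (_ / _); ring.
Qed.

Lemma is_derive_lnJ_time q0 b0 g0 : admissible TimeLike q0 b0 g0 ->
  exists Z, forall (q b g : R -> R) t dq db dg,
  is_derive t 1 q dq -> is_derive t 1 b db -> is_derive t 1 g dg ->
  q t = q0 -> b t = b0 -> g t = g0 ->
  is_derive t 1 (fun z => J_fun TimeLike (q z) (b z) (g z))
    (J_fun TimeLike q0 b0 g0 *
      (g0 / (2 * B_fun TimeLike q0 b0 g0) * (b0 * dq - q0 * db) + Z * dg)).
Proof.
move=> adm; have h0 := h_of_gt0 adm; have hr := h_of_radicand_gt0 adm.
have [X0 Y0] := time_factors_gt0 adm.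
pose h := h_of TimeLike g0.
pose X := b0 - gminus g0 * q0; pose Y := gplus g0 * q0 - b0.
(* The partial derivative in $g$ of $\ln J=-\frac G4\ln(X/Y)$ at fixed $q$, $b$: the first term
   comes from $dG/dg=h^{-3}$, the second from the dependence of $g_\pm$ on $g$. *)
exists (- (ln (X / Y) / (4 * h ^+ 3)) - g0 / (4 * h) *
   ((2^-1 + g0 / (4 * h)) * q0 * Y - X * (g0 / (4 * h) - 2^-1) * q0) / (X * Y)).
move=> q b g t dq db dg dqt dbt dgt qt bt gt; subst q0 b0 g0.
have dh := is_derive_h_of hr dgt.
have dG := is_derive_G_of hr dgt.
have hn0 : h != 0 by rewrite gt_eqF.
have Xn0 : X != 0 by rewrite gt_eqF.
have Yn0 : Y != 0 by rewrite gt_eqF.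
have XY0 : 0 < X / Y by rewrite divr_gt0.
pose r z := (b z - gminus (g z) * q z) / (gplus (g z) * q z - b z).
have dr : is_derive t 1 r
    (((db - (gminus (g t) * dq - (2^-1 + g t / (4 * h)) * dg * q t)) * Y
      - X * (gplus (g t) * dq + (g t / (4 * h) - 2^-1) * dg * q t - db)) / Y ^+ 2).
  rewrite /r /gminus /gplus; diff_eq.
  rewrite /= -/h -/(gminus _) -/(gplus _) -/X -/Y /gminus /gplus -/h.
  by field; apply/andP.
(* [powR] treats base 0 separately; near [t] the base is positive and only the exponential form
   remains. *)
apply: (near_eq_is_derive (f := fun z => expR (- (G_of TimeLike (g z) / 4) *
   ln (r z)))).
  near=> z; rewrite /= /powR ifF //; apply/negbTE; rewrite gt_eqF //.
  by near: z; exact: (is_derive_near_gt0 dr).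
have dln := is_derive_scalar_comp (f := r) (is_derive1_ln XY0) dr.
diff_eq.
rewrite /= /powR gt_eqF // -B_time_factor -/X -/Y /G_of -/h.
set E := expR _; set l := ln _.
(* With $X$ and $Y$ as independent variables in place of $q$ and $b$, the goal is an identity of
   rational functions that does not involve the relation between $h$ and $g$. *)
have qXY : q t = (X + Y) / (2 * h) by rewrite /X /Y /gminus /gplus -/h; field.
have bXY : b t = (gminus (g t) * Y + gplus (g t) * X) / (2 * h).
  by rewrite /X /Y /gminus /gplus -/h; field.
clearbody E l X Y; rewrite {}qXY {}bXY /gminus /gplus -/h.
by field; rewrite hn0 Xn0 Yn0.
Unshelve. all: by end_near.
Qed.

Lemma atan_inv (x : R) : 0 < x -> atan x^-1 = pi / 2 - atan x.
Proof.
move=> x0; have ax0 : 0 < atan x by rewrite -atan0 lt_atan.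
have aI := atan_ltpi2 x.
apply: tan_inj; rewrite ?in_itv /= ?atan_gtNpi2 ?atan_ltpi2 //.
  by apply/andP; split; lra.
rewrite atanK /tan sinB cosB sin_pihalf cos_pihalf !mul0r !mul1r subr0 add0r.
have s0 : sin (atan x) != 0.
  by rewrite gt_eqF // sin_gt0_pi // ax0 /=; lra.
have c0 : cos (atan x) != 0.
  by rewrite gt_eqF // cos_gt0_pihalf // atan_gtNpi2 atan_ltpi2.
by rewrite -[in LHS](atanK x) /tan invf_div.
Qed.

(* Away from [b = 0] the angle is an arctangent of [L / (h b)], near [b = 0]
   (where [L > 0]) it is one of [h b / L]. *)
Lemma f_fun_flip q b g : 0 < h_of SpaceLike g -> 0 < q + g / 2 * b ->
  f_fun q b g = - (pi / 2) - atan (G_of SpaceLike g / 2)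
                - atan (h_of SpaceLike g * b / (q + g / 2 * b)).
Proof.
move=> h0 L0; rewrite /f_fun; set L := q + _ in L0 *; set h := h_of _ _ in h0 *.
case: ltrgtP => [b0|b0|->]; last by rewrite mulr0 mul0r atan0 subr0.
  have -> : L / (h * b) = - (h * (- b) / L)^-1 by rewrite invf_div mulrN invrN mulrN opprK.
  have -> : h * b / L = - (h * (- b) / L) by rewrite mulrN mulNr opprK.
  rewrite !atanN atan_inv; first by ring.
  by rewrite divr_gt0 // mulr_gt0 // oppr_gt0.
rewrite -[L / _]invf_div atan_inv; last by rewrite divr_gt0 // mulr_gt0.
by field.
Qed.

(** Turns the denominators $1+(L/(hb))^2$ and $1+(hb/L)^2$ of the arctangent derivatives into
    multiples of $-B$, so that all signs of $b$ lead to one formula. *)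
Lemma space_L_sqr q b g : admissible SpaceLike q b g ->
  h_of SpaceLike g ^+ 2 * b ^+ 2 + (q + g / 2 * b) ^+ 2 = - B_fun SpaceLike q b g.
Proof. by move=> /h_of_sqr ->; rewrite /B_fun /=; field. Qed.

(** The differential of the polar angle, $(hb\,dL-L\,d(hb))/(h^2b^2+L^2)$, minus that of
    $\arctan(G/2)$. The additive constants of the branches disappear, and $d(hb)$ contributes a
    $dg$-term through $dh=-g\,dg/(4h)$. *)
Lemma is_derive_f_fun (q b g : R -> R) t dq db dg :
  is_derive t 1 q dq -> is_derive t 1 b db -> is_derive t 1 g dg ->
  admissible SpaceLike (q t) (b t) (g t) ->
  is_derive t 1 (fun z => f_fun (q z) (b z) (g z))
   (let h := h_of SpaceLike (g t) in
    let L := q t + g t / 2 * b t in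
    - (h * b t * (dq + g t / 2 * db + b t / 2 * dg)
       + b t * L * g t / (4 * h) * dg - h * L * db)
      / B_fun SpaceLike (q t) (b t) (g t)
    - dg / (2 * h)).
Proof.
move=> dqt dbt dgt adm /=.
have h0 := h_of_gt0 adm; have hr := h_of_radicand_gt0 adm.
have h2 := h_of_sqr adm; have BL := space_L_sqr adm.
have dh := is_derive_h_of hr dgt.
have dG := is_derive_G_of hr dgt.
have B0 := B_fun_neq0 adm.
have L_derive : is_derive t 1 (fun z => q z + g z / 2 * b z)
    (dq + g t / 2 * db + b t / 2 * dg).
  by diff_eq; field.
pose h := h_of SpaceLike (g t); pose L := q t + g t / 2 * b t.
have hn0 : h != 0 by rewrite gt_eqF.
have dGa : is_derive t 1 (fun z => atan (G_of SpaceLike (g z) / 2))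
    (dg / (2 * h)).
  diff_eq; rewrite /G_of -/h.
  (* In the space-like sector $h^2+g^2/4=1$, hence $1+(G/2)^2=h^{-2}$. *)
  have -> : 1 + (g t / h / 2) ^+ 2 = (h ^+ 2 + g t ^+ 2 / 4) / h ^+ 2 by field.
  have -> : h ^+ 2 + g t ^+ 2 / 4 = 1 by rewrite h2 /=; ring.
  by field.
case: (ltrgtP (b t) 0) => b0.
- apply: (near_eq_is_derive (f := fun z => - atan (G_of SpaceLike (g z) / 2)
     + atan ((q z + g z / 2 * b z) / (h_of SpaceLike (g z) * b z)))).
    near=> z; rewrite /f_fun ifT //; near: z.
    exact: (is_derive_near_lt0 dbt).
  have hb0 : h_of SpaceLike (g t) * b t != 0 by rewrite mulf_neq0 // lt_eqF.
  have bn0 : b t != 0 by rewrite lt_eqF.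
  diff_eq; rewrite -/h -/L.
  have -> : 1 + (L / (h * b t)) ^+ 2 = - B_fun SpaceLike (q t) (b t) (g t) / (h * b t) ^+ 2.
    by rewrite -BL -/h -/L; field; rewrite hn0 bn0.
  by rewrite /=; field; rewrite B0 hn0 bn0.
- apply: (near_eq_is_derive (f := fun z => - pi - atan (G_of SpaceLike (g z) / 2)
     + atan ((q z + g z / 2 * b z) / (h_of SpaceLike (g z) * b z)))).
    near=> z.
    have bz : 0 < b z by near: z; exact: (is_derive_near_gt0 dbt).
    by rewrite /f_fun ltNge ltW //= bz.
  have hb0 : h_of SpaceLike (g t) * b t != 0 by rewrite mulf_neq0 // gt_eqF.
  have bn0 : b t != 0 by rewrite gt_eqF.
  diff_eq; rewrite -/h -/L.
  have -> : 1 + (L / (h * b t)) ^+ 2 = - B_fun SpaceLike (q t) (b t) (g t) / (h * b t) ^+ 2.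
    by rewrite -BL -/h -/L; field; rewrite hn0 bn0.
  by rewrite /=; field; rewrite B0 hn0 bn0.
(* At $b=0$ one has $L=q>0$, and $L$ and $h$ stay positive nearby, so [f_fun_flip] gives a single
   expression valid on both sides of $b=0$. *)
- have L0 : 0 < L by rewrite /L b0 mulr0 addr0; case: adm.
  apply: (near_eq_is_derive (f := fun z => - (pi / 2)
     - atan (G_of SpaceLike (g z) / 2)
     - atan (h_of SpaceLike (g z) * b z / (q z + g z / 2 * b z)))).
    near=> z; rewrite f_fun_flip //; near: z.
      exact: (is_derive_near_gt0 dh).
    exact: (is_derive_near_gt0 L_derive).
  have Ln0 : q t + g t / 2 * b t != 0 by rewrite gt_eqF.
  diff_eq; rewrite -/h -/L.
  have -> : 1 + (h * b t / L) ^+ 2 = - B_fun SpaceLike (q t) (b t) (g t) / L ^+ 2.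
    by rewrite -BL -/h -/L; field.
  by rewrite /=; field; rewrite B0 hn0.
Unshelve. all: by end_near.
Qed.

Lemma is_derive_lnJ_space q0 b0 g0 : admissible SpaceLike q0 b0 g0 ->
  exists Z, forall (q b g : R -> R) t dq db dg,
  is_derive t 1 q dq -> is_derive t 1 b db -> is_derive t 1 g dg ->
  q t = q0 -> b t = b0 -> g t = g0 ->
  is_derive t 1 (fun z => J_fun SpaceLike (q z) (b z) (g z))
    (J_fun SpaceLike q0 b0 g0 *
      (g0 / (2 * B_fun SpaceLike q0 b0 g0) * (b0 * dq - q0 * db) + Z * dg)).
Proof.
move=> adm; have h0 := h_of_gt0 adm; have hr := h_of_radicand_gt0 adm.
have B0 := B_fun_neq0 adm.
pose h := h_of SpaceLike g0; pose L := q0 + g0 / 2 * b0.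
have hn0 : h != 0 by rewrite gt_eqF.
(* The partial derivative in $g$ of $\ln J=-\frac G2f$ at fixed $q$, $b$, by [is_derive_f_fun] with
   $dq=db=0$. *)
exists (- (f_fun q0 b0 g0 / (2 * h ^+ 3)) + g0 / (2 * h) *
   ((h * b0 ^+ 2 / 2 + b0 * L * g0 / (4 * h)) / B_fun SpaceLike q0 b0 g0
    + 1 / (2 * h))).
move=> q b g t dq db dg dqt dbt dgt qt bt gt; subst q0 b0 g0.
have dG := is_derive_G_of hr dgt.
have df := is_derive_f_fun dqt dbt dgt adm.
rewrite /J_fun; diff_eq.
set f := f_fun _ _ _; set E := expR _; rewrite /G_of -/h /L.
by field; rewrite hn0 B0.
Qed.

(* The coefficient [Z] is the logarithmic [g]-derivative of [J^2]; its value is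
   irrelevant, what matters is that it does not depend on the curve. *)
Lemma is_derive_J_fun_sqr s q0 b0 g0 : admissible s q0 b0 g0 ->
  exists Z, forall (V : normedModType R) (q b g : V -> R) (x v : V) dq db dg,
  is_derive x v q dq -> is_derive x v b db -> is_derive x v g dg ->
  q x = q0 -> b x = b0 -> g x = g0 ->
  is_derive x v (fun z => J_fun s (q z) (b z) (g z) ^+ 2)
    (J_fun s q0 b0 g0 ^+ 2 *
      (g0 / B_fun s q0 b0 g0 * (b0 * dq - q0 * db) + Z * dg)).
Proof.
move=> adm; have B0 := B_fun_neq0 adm.
have [Z HZ] : exists Z, forall (q b g : R -> R) t dq db dg,
    is_derive t 1 q dq -> is_derive t 1 b db -> is_derive t 1 g dg ->
    q t = q0 -> b t = b0 -> g t = g0 ->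
    is_derive t 1 (fun z => J_fun s (q z) (b z) (g z))
    (J_fun s q0 b0 g0 *
      (g0 / (2 * B_fun s q0 b0 g0) * (b0 * dq - q0 * db) + Z * dg)).
  by case: s adm {B0} => adm; [exact: is_derive_lnJ_time|exact: is_derive_lnJ_space].
exists (2 * Z) => V q b g x v dq db dg /is_derive_lineP dqx /is_derive_lineP dbx.
move=> /is_derive_lineP dgx qx bx gx; apply/is_derive_lineP.
have x0 : 0 *: v + x = x by rewrite scale0r add0r.
have dJ := HZ _ _ _ _ _ _ _ dqx dbx dgx.
rewrite /= x0 in dJ; have {}dJ := dJ qx bx gx.
by diff_eq; rewrite x0 qx bx gx; field.
Qed.

End Indicatrix.

(** * Replacing functions by local expressions along a line *)

Section Lines.
Context {R : realType} {V : normedModType R}.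
Implicit Types (f k : V -> R) (x v : V).

(** Agreement is required only on the line through [x]; this is the form in which closed formulas
    valid inside the sector enter a partial derivative. *)
Lemma is_derive_line_eq f k x v df :
  (\forall t \near (0 : R), f (t *: v + x) = k (t *: v + x)) ->
  is_derive x v f df -> is_derive x v k df.
Proof.
move=> E /is_derive_lineP d; apply/is_derive_lineP.
exact: near_eq_is_derive E d.
Qed.

Lemma is_derive_line_gt0 f x v df : is_derive x v f df -> 0 < f x ->
  \forall t \near (0 : R), 0 < f (t *: v + x).
Proof.
move=> /is_derive_lineP d fx; apply: (is_derive_near_gt0 d).
by rewrite scale0r add0r.
Qed.

Lemma is_derive_normr s f x v df : 0 < eps s * f x -> is_derive x v f df ->
  is_derive x v (fun z => `|f z|) (eps s * df).
Proof.
move=> f0 d; have d' : is_derive x v (fun z => eps s * f z) (eps s * df).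
  by diff_eq; ring.
apply: is_derive_line_eq d'.
near=> t; have : 0 < eps s * f (t *: v + x).
  near: t; apply: (is_derive_line_gt0 (f := fun z => eps s * f z)) => //.
have [->|->] : eps s = 1 :> R \/ eps s = -1 :> R by case: (s); [left|right].
  by rewrite mul1r => /gtr0_norm ->.
by rewrite mulN1r oppr_gt0 => /ltr0_norm ->.
Unshelve. all: by end_near.
Qed.

End Lines.

(** * $F^2$ and the momenta $y_k$ when $a$, $b$, $g$ and $y$ vary together *)

Section Family.
Context {R : realType} {n : nat}.
Implicit Types (s : sector) (A : 'M[R]_n) (be y : 'rV[R]_n) (g : R) (i j k : 'I_n).

Definition lower A y k : R := \sum_j A k j * y 0 j.

Definition y_low_fun s A be g y k : R :=
  J_of s A be g y ^+ 2 * (lower A y k - g * q_of A be y * be 0 k).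

Lemma gamma_ofE A be y :
  gamma_of A be y = \sum_k y 0 k * lower A y k + b_of be y ^+ 2.
Proof.
have -> : b_of be y ^+ 2 = \sum_i \sum_j be 0 i * be 0 j * y 0 i * y 0 j.
  rewrite expr2 /b_of mulr_suml; apply: eq_bigr => i _.
  by rewrite mulr_sumr; apply: eq_bigr => j _; ring.
rewrite -big_split; apply: eq_bigr => i _ /=.
rewrite /lower mulr_sumr -big_split; apply: eq_bigr => j _ /=.
by ring.
Qed.

Lemma in_sectorP s A be g y : in_sector s A be g y ->
  [/\ 0 < eps s * gamma_of A be y, gamma_of A be y = eps s * q_of A be y ^+ 2,
   B_of A be g y = B_fun s (q_of A be y) (b_of be y) g &
   admissible s (q_of A be y) (b_of be y) g].
Proof.
move=> Hs.
have e0 : 0 < eps s * gamma_of A be y by case: s Hs => /= -[]; lra.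
have q2 : q_of A be y ^+ 2 = eps s * gamma_of A be y.
  rewrite /q_of sqr_sqrtr //; case: s {Hs} e0 => /=.
    by rewrite mul1r => /gtr0_norm.
  by rewrite mulN1r oppr_gt0 => /ltr0_norm.
have gE : gamma_of A be y = eps s * q_of A be y ^+ 2.
  by rewrite q2 mulrA -expr2 eps_sqr mul1r.
have BE : B_of A be g y = B_fun s (q_of A be y) (b_of be y) g.
  by rewrite /B_of /B_fun -gE.
split=> //; split; last by case: s Hs {e0 q2 gE} BE => /= -[] // _ H <-.
rewrite /q_of sqrtr_gt0 normr_gt0; apply: contraTneq e0 => ->.
by rewrite mulr0 ltxx.
Qed.

(** The quantification over [V] lets one fixed [Z] serve derivatives in $x$ and $y$, where [V] is
    the coordinate space, and in the parameter $g$, where [V] is [R]. *)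
Definition log_J2_dg s q0 b0 g0 (Z : R) : Prop :=
  forall (V : normedModType R) (q b g : V -> R) (x v : V) dq db dg,
  is_derive x v q dq -> is_derive x v b db -> is_derive x v g dg ->
  q x = q0 -> b x = b0 -> g x = g0 ->
  is_derive x v (fun z => J_fun s (q z) (b z) (g z) ^+ 2)
    (J_fun s q0 b0 g0 ^+ 2 *
      (g0 / B_fun s q0 b0 g0 * (b0 * dq - q0 * db) + Z * dg)).

Section Derivatives.
Context {V : normedModType R} (x v : V) (s : sector).
Context (A : V -> 'M[R]_n) (be : V -> 'rV[R]_n) (g : V -> R) (y : V -> 'rV[R]_n).
Context (dA : 'I_n -> 'I_n -> R) (dbe : 'I_n -> R) (dg : R) (dy : 'I_n -> R).
Context (dAx : forall i j, is_derive x v (fun z => A z i j) (dA i j)).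
Context (dbex : forall i, is_derive x v (fun z => be z 0 i) (dbe i)).
Context (dgx : is_derive x v g dg).
Context (dyx : forall i, is_derive x v (fun z => y z 0 i) (dy i)).

(** The differentials are expressions in arbitrary [dA], [dbe], [dg], [dy]. Keeping only [dy], only
    [dg], or all but [dy] gives the fibre, parameter and base derivatives. *)
Definition d_b := \sum_i (dbe i * y x 0 i + be x 0 i * dy i).

Definition d_lower k := \sum_j (dA k j * y x 0 j + A x k j * dy j).

Definition d_quad :=
  \sum_k (dy k * lower (A x) (y x) k + y x 0 k * d_lower k).

Definition d_gamma := d_quad + 2 * b_of (be x) (y x) * d_b.

Definition d_q := eps s * d_gamma / (2 * q_of (A x) (be x) (y x)).

Lemma is_derive_b_of : is_derive x v (fun z => b_of (be z) (y z)) d_b.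
Proof. by apply: is_derive_fun_sum => i; apply: is_derive_fun_mul. Qed.

Lemma is_derive_lower k : is_derive x v (fun z => lower (A z) (y z) k) (d_lower k).
Proof. by apply: is_derive_fun_sum => i; apply: is_derive_fun_mul. Qed.

Lemma is_derive_gamma_of :
  is_derive x v (fun z => gamma_of (A z) (be z) (y z)) d_gamma.
Proof.
under eq_fun do rewrite gamma_ofE.
apply: is_derive_fun_add; last exact: is_derive_fun_sqr is_derive_b_of.
apply: is_derive_fun_sum => i; apply: is_derive_fun_mul => //.
exact: is_derive_lower.
Qed.

Context (sec : in_sector s (A x) (be x) (g x) (y x)).

Lemma is_derive_q_of : is_derive x v (fun z => q_of (A z) (be z) (y z)) d_q.
Proof.
have [e0 _ _ [q0 _]] := in_sectorP sec.
have d := is_derive_normr (f := fun z => gamma_of (A z) (be z) (y z)) e0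
  is_derive_gamma_of.
apply: is_derive_fun_sqrt d.
by move: q0; rewrite /q_of sqrtr_gt0.
Qed.

(** Openness of the sector along the line: it lets the closed forms of $y_k$ and $g_{ij}$, proved
    inside the sector, be differentiated. *)
Lemma in_sector_near :
  \forall t \near (0 : R), in_sector s (A (t *: v + x)) (be (t *: v + x))
    (g (t *: v + x)) (y (t *: v + x)).
Proof.
have [e0 _ BE [q0 _]] := in_sectorP sec.
have dgam := is_derive_gamma_of.
have db := is_derive_b_of; have dq := is_derive_q_of.
have near_gam : \forall t \near (0 : R),
   0 < eps s * gamma_of (A (t *: v + x)) (be (t *: v + x)) (y (t *: v + x)).
  exact: (is_derive_line_gt0
    (is_derive_fun_mul (is_derive_fun_cst (eps s) x v) dgam) e0).
case: (s) sec near_gam => /= -[gam0 H] near_gam.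
  have near_B : \forall t \near (0 : R),
      0 < B_of (A (t *: v + x)) (be (t *: v + x)) (g (t *: v + x)) (y (t *: v + x)).
    notypeclasses refine (is_derive_line_gt0
      (f := fun z => B_of (A z) (be z) (g z) (y z)) _ H).
    by rewrite /B_of; diff.
  near=> t; split; last by near: t.
  by rewrite -[ltRHS]mul1r; near: t.
have near_g1 : \forall t \near (0 : R), 0 < g (t *: v + x) + 2.
  notypeclasses refine (is_derive_line_gt0 (f := fun z => g z + 2) _ _); [diff|lra].
have near_g2 : \forall t \near (0 : R), 0 < 2 - g (t *: v + x).
  notypeclasses refine (is_derive_line_gt0 (f := fun z => 2 - g z) _ _); [diff|lra].
near=> t; split.
  by rewrite -oppr_gt0 -mulN1r; near: t.
by apply/andP; split; [rewrite -subr_gt0 opprK|rewrite -subr_gt0]; near: t.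
Unshelve. all: by end_near.
Qed.

Let q0 := q_of (A x) (be x) (y x).
Let b0 := b_of (be x) (y x).
Let B0 := B_of (A x) (be x) (g x) (y x).
Let J2 := J_of s (A x) (be x) (g x) (y x) ^+ 2.

Context (Z : R) (HZ : log_J2_dg s q0 b0 (g x) Z).

Definition d_J2 := J2 * (g x / B0 * (b0 * d_q - q0 * d_b) + Z * dg).

Lemma is_derive_J_of_sqr :
  is_derive x v (fun z => J_of s (A z) (be z) (g z) (y z) ^+ 2) d_J2.
Proof.
have [_ _ BE _] := in_sectorP sec; rewrite /d_J2 /B0 BE.
exact: (HZ is_derive_q_of is_derive_b_of dgx).
Qed.

Lemma is_derive_F2 :
  is_derive x v (fun z => F2 s (A z) (be z) (g z) (y z))
    (J2 * (d_quad - 2 * g x * q0 * d_b + (B0 * Z - b0 * q0) * dg)).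
Proof.
have [_ gE BE adm] := in_sectorP sec; have [qgt0 _] := adm.
have dgam := is_derive_gamma_of; have db := is_derive_b_of.
have dq := is_derive_q_of; have dJ := is_derive_J_of_sqr.
have B0n : B0 != 0 by rewrite /B0 BE; exact: B_fun_neq0 adm.
have q0n : q0 != 0 by rewrite gt_eqF.
rewrite /F2 /B_of; diff_eq.
rewrite -/(B_of _ _ _ _) -/B0 /d_J2 -/J2 -/b0 -/q0.
have -> : d_quad = d_gamma - 2 * b0 * d_b by rewrite /d_gamma /b0; ring.
rewrite /d_q -/q0.
by field; rewrite ?B0n ?q0n.
Qed.

Lemma is_derive_y_low_fun k :
  is_derive x v (fun z => y_low_fun s (A z) (be z) (g z) (y z) k)
   (d_J2 * (lower (A x) (y x) k - g x * q0 * be x 0 k)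
    + J2 * (d_lower k - dg * q0 * be x 0 k - g x * d_q * be x 0 k
            - g x * q0 * dbe k)).
Proof.
have dq := is_derive_q_of; have dJ := is_derive_J_of_sqr.
have dl := is_derive_lower k.
rewrite /y_low_fun; diff_eq.
by rewrite -/q0 -/J2; ring.
Qed.

End Derivatives.
End Family.

(** * Closed forms of $y_k$ and $g_{ij}$, and Euler's relations *)

Section FinslerMetric.
Context {R : realType} {n : nat}.
Implicit Types (s : sector) (A : 'M[R]_n) (be y : 'rV[R]_n) (g : R) (i j k : 'I_n).

Lemma ex_log_J2_dg s A be g y : in_sector s A be g y ->
  exists Z, log_J2_dg s (q_of A be y) (b_of be y) g Z.
Proof. by move=> /in_sectorP[_ _ _ /is_derive_J_fun_sqr]. Qed.

Lemma is_derive_coord (x v : 'rV[R]_n) i :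
  is_derive x v (fun z : 'rV[R]_n => z 0 i) (v 0 i).
Proof.
apply/is_derive_lineP; under eq_fun do rewrite mxE mxE.
have d := is_derive_id (0 : R) (1 : R).
have := is_derive_fun_add (is_derive_fun_mul d (is_derive_fun_cst (v 0 i) _ _))
  (is_derive_fun_cst (x 0 i) _ _).
by move=> /is_derive_eq; apply; rewrite /=; ring.
Qed.

Lemma sum_delta k (w : 'I_n -> R) : \sum_i w i * (delta_mx 0 k : 'rV[R]_n) 0 i = w k.
Proof.
rewrite (bigD1 k) //= big1 => [|i ik]; rewrite !mxE ?eqxx ?mulr1 ?addr0 //.
by rewrite (negbTE ik) mulr0.
Qed.

Section Vertical.
Context (s : sector) (A : 'M[R]_n) (be : 'rV[R]_n) (g : R).
Context (A_sym : A^T = A).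

Lemma A_symE i j : A i j = A j i. Proof. by rewrite -[in LHS]A_sym mxE. Qed.

Lemma d_b_vertical y k :
  d_b y (fun=> be) id (fun=> 0) ((delta_mx 0 k : 'rV[R]_n) 0) = be 0 k.
Proof.
by rewrite /d_b; under eq_bigr do rewrite mul0r add0r; rewrite sum_delta.
Qed.

Lemma d_lower_vertical y k j :
  d_lower y (fun=> A) id (fun _ _ => 0) ((delta_mx 0 k : 'rV[R]_n) 0) j = A j k.
Proof.
by rewrite /d_lower; under eq_bigr do rewrite mul0r add0r; rewrite sum_delta.
Qed.

Lemma d_quad_vertical y k :
  d_quad y (fun=> A) id (fun _ _ => 0) ((delta_mx 0 k : 'rV[R]_n) 0) = 2 * lower A y k.
Proof.
rewrite /d_quad; under eq_bigr do rewrite d_lower_vertical mulrC.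
rewrite big_split /= sum_delta mulr2n mulrDl !mul1r; congr (_ + _).
by apply: eq_bigr => i _; rewrite mulrC A_symE.
Qed.

Lemma is_derive_F2_vertical y k : in_sector s A be g y ->
  is_derive y (delta_mx 0 k) (F2 s A be g) (2 * y_low_fun s A be g y k).
Proof.
move=> sec; have [Z HZ] := ex_log_J2_dg sec.
have dc (a : R) : is_derive y (delta_mx 0 k : 'rV[R]_n) (fun=> a) 0.
  by exact: is_derive_fun_cst.
have := is_derive_F2 (A := fun=> A) (be := fun=> be) (g := fun=> g) (y := id)
  (fun i j => dc _) (fun i => dc _) (dc _)
  (fun i => is_derive_coord y (delta_mx 0 k) i) sec HZ.
move=> /is_derive_eq; apply; rewrite d_quad_vertical d_b_vertical /y_low_fun.
by ring.
Qed.

Lemma y_low_eq y k : in_sector s A be g y ->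
  y_low s A be g y k = y_low_fun s A be g y k.
Proof.
move=> /(is_derive_F2_vertical k)[_]; rewrite /y_low /partial => ->.
by field.
Qed.

End Vertical.

(** $v_k=r_{kj}y^j$ is half the fibre gradient of $\gamma$, so $dq=(\epsilon/q)v_k\,dy^k$; hence
    $g_{ij}$ is naturally written in $v_i$ and $b_i$. *)
Definition v_low A be y k : R := lower A y k + b_of be y * be 0 k.

Definition metric_fun s A be g y i j : R :=
  let q := q_of A be y in let b := b_of be y in let v := v_low A be y in
  J_of s A be g y ^+ 2 * (A i j + g / B_of A be g y *
    (eps s * b / q * v i * v j - q * (v i * be 0 j + be 0 i * v j)
     + q * (b + g * q) * be 0 i * be 0 j)).

Lemma finsler_metric_eq s A be g y i j : A^T = A -> in_sector s A be g y ->
  finsler_metric s A be g y i j = metric_fun s A be g y i j.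
Proof.
move=> A_sym sec; have [Z HZ] := ex_log_J2_dg sec.
have [_ gE BE adm] := in_sectorP sec; have B0 := B_fun_neq0 adm.
have q0 : q_of A be y != 0 by case: adm => /gt_eqF ->.
have dc (a : R) : is_derive y (delta_mx 0 i : 'rV[R]_n) (fun=> a) 0.
  by exact: is_derive_fun_cst.
have dy k := is_derive_coord y (delta_mx 0 i) k.
have dyl := is_derive_y_low_fun (A := fun=> A) (be := fun=> be) (g := fun=> g)
  (y := id) (fun i j => dc _) (fun i => dc _) (dc _) dy sec HZ j.
have sec_near := in_sector_near (A := fun=> A) (be := fun=> be) (g := fun=> g)
  (y := id) (fun i j => dc _) (fun i => dc _) (dc _) dy sec.
have d2 := is_derive_fun_mul (dc 2) dyl.
(* The outer derivative acts on [partial j F2], whose closed form must hold at nearby points and not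
   only at [y]. *)
have E : \forall t \near (0 : R),
    2 * y_low_fun s A be g (t *: delta_mx 0 i + y) j =
    partial j (F2 s A be g) (t *: delta_mx 0 i + y).
  near=> t; have secz : in_sector s A be g (t *: delta_mx 0 i + y) by near: t.
  by case: (is_derive_F2_vertical A_sym j secz).
have [_] := is_derive_line_eq (k := partial j (F2 s A be g)) E d2.
rewrite mxE /partial => ->.
rewrite /d_J2 /d_q /d_gamma d_quad_vertical // d_b_vertical d_lower_vertical.
rewrite /metric_fun /v_low (A_symE A_sym i j) BE.
rewrite -/(v_low A be y) /B_fun in B0 *.
set J2 := _ ^+ 2; set q := q_of _ _ _ in q0 B0 *; set b := b_of _ _ in B0 *.
set wi := lower A y i; set wj := lower A y j.
(* The identity uses $\epsilon^2=1$; substituting both values leaves a purely rational identity to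
   [field]. *)
have [e|e] : eps s = 1 :> R \/ eps s = -1 :> R by case: (s); [left|right].
  by rewrite e in B0 *; field; rewrite q0 -[q ^+ 2]mul1r.
by rewrite e in B0 *; field; rewrite q0.
Unshelve. all: by end_near.
Qed.

Lemma sum_v_low A be y (T : 'I_n -> R) :
  \sum_j v_low A be y j * T j =
  \sum_j lower A y j * T j + b_of be y * \sum_j be 0 j * T j.
Proof.
rewrite mulr_sumr -big_split; apply: eq_bigr => j _ /=.
by rewrite /v_low; ring.
Qed.

(** Since $g_{ij}-J^2a_{ij}$ is a form in $v$ and $b$, the contraction depends on $T$ only through
    $a_{ij}T^j$ and the scalars $v_jT^j$, $b_jT^j$. *)
Lemma metric_fun_contract s A be g y (T : 'I_n -> R) i :
  let q := q_of A be y in let b := b_of be y in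
  let v := v_low A be y in
  let bT := \sum_j be 0 j * T j in let vT := \sum_j v j * T j in
  \sum_j metric_fun s A be g y i j * T j =
  J_of s A be g y ^+ 2 * (\sum_j A i j * T j + g / B_of A be g y *
    (eps s * b / q * vT * v i - q * (v i * bT + be 0 i * vT)
     + q * (b + g * q) * be 0 i * bT)).
Proof.
move=> q b v bT vT; rewrite /metric_fun -/q -/b -/v.
set J2 := J_of _ _ _ _ _ ^+ 2; set G := g / _.
transitivity (\sum_j (J2 * (A i j * T j)
   + J2 * G * (eps s * b / q * v i - q * be 0 i) * (v j * T j)
   + J2 * G * (q * (b + g * q) * be 0 i - q * v i) * (be 0 j * T j))).
  by apply: eq_bigr => j _; ring.
by rewrite !big_split /= -!mulr_sumr -/bT -/vT; ring.
Qed.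

(** Euler's relation $g_{ij}y^j=y_i$, read off the closed forms instead of from the homogeneity of
    $F^2$. *)
Lemma metric_fun_y s A be g y i : in_sector s A be g y ->
  \sum_j metric_fun s A be g y i j * y 0 j = y_low_fun s A be g y i.
Proof.
move=> sec; have [_ gE BE adm] := in_sectorP sec; have B0 := B_fun_neq0 adm.
have q0 : q_of A be y != 0 by case: adm => /gt_eqF ->.
rewrite metric_fun_contract sum_v_low.
have -> : \sum_j lower A y j * y 0 j = gamma_of A be y - b_of be y ^+ 2.
  by rewrite gamma_ofE addrK; apply: eq_bigr => j _; rewrite mulrC.
rewrite -/(lower A y i) -/(b_of be y) /y_low_fun gE /v_low.
rewrite BE /B_fun in B0 *; congr (_ * _).
set q := q_of _ _ _ in q0 B0 *; set b := b_of _ _ in B0 *.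
have [e|e] : eps s = 1 :> R \/ eps s = -1 :> R by case: (s); [left|right].
  by rewrite e in B0 *; field; rewrite q0 -[q ^+ 2]mul1r.
by rewrite e in B0 *; field; rewrite q0.
Qed.

Lemma y_low_fun_y s A be g y : 
  \sum_i y 0 i * y_low_fun s A be g y i = F2 s A be g y.
Proof.
rewrite /F2 /B_of gamma_ofE.
under eq_bigr => i _ do rewrite /y_low_fun mulrCA mulrBr mulrCA.
rewrite -mulr_sumr sumrB -mulr_sumr [_ - b_of _ _ ^+ 2]addrAC addrK.
rewrite mulrC; congr (_ * _); congr (_ - _).
rewrite -mulrA [b_of _ _ * _]mulrC mulrA; congr (_ * _).
by apply: eq_bigr => j _; rewrite mulrC.
Qed.

End FinslerMetric.

(** * The spray in terms of $y_k$ and $F^2$, and invertibility of $g_{ij}$ *)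

Section Spray.
Context {R : realType} {n : nat}.
Implicit Types (s : sector) (x y : 'rV[R]_n) (i j k l m : 'I_n).

Lemma partial_lower (G : 'rV[R]_n -> 'M[R]_n) x y m k :
  (forall l, derivable (fun z => G z k l) x (delta_mx 0 m)) ->
  is_derive x (delta_mx 0 m) (fun z => lower (G z) y k)
    (\sum_l partial m (fun z => G z k l) x * y 0 l).
Proof.
move=> dG; apply: is_derive_fun_sum => l.
have d : is_derive x (delta_mx 0 m) (fun z => G z k l) (partial m (fun z => G z k l) x).
  exact: DeriveDef.
apply: (is_derive_eq (is_derive_fun_mul d (is_derive_fun_cst (y 0 l) _ _))).
by rewrite mulr0 addr0.
Qed.

(* For Finsler components the inner derivatives are those of the momenta [y_k]
   and of [F^2], by Euler's theorem. *)
Lemma christoffel_quadE (G : 'rV[R]_n -> 'M[R]_n) x y i :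
  (forall m k l, derivable (fun z => G z k l) x (delta_mx 0 m)) ->
  christoffel_quad G x y i = \sum_k invmx (G x) i k *
    (\sum_m y 0 m * partial m (fun z => lower (G z) y k) x
     - 2^-1 * partial k (fun z => \sum_l y 0 l * lower (G z) y l) x).
Proof.
move=> dG; pose P m k l := partial m (fun z => G z k l) x.
have PL m k : partial m (fun z => lower (G z) y k) x = \sum_l P m k l * y 0 l.
  by have [_] := partial_lower y (dG m k).
have PQ k : partial k (fun z => \sum_l y 0 l * lower (G z) y l) x =
    \sum_l \sum_m P k l m * y 0 l * y 0 m.
  have d : is_derive x (delta_mx 0 k) (fun z => \sum_l y 0 l * lower (G z) y l)
     (\sum_l (0 * lower (G x) y l + y 0 l * \sum_m P k l m * y 0 m)).
    apply: is_derive_fun_sum => l.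
    exact: is_derive_fun_mul (is_derive_fun_cst (y 0 l) _ _) (partial_lower y (dG k l)).
  case: d => _; rewrite {1}/partial => ->; apply: eq_bigr => l _.
  by rewrite mul0r add0r mulr_sumr; apply: eq_bigr => m _; ring.
transitivity (\sum_k invmx (G x) i k * (2^-1 *
   (\sum_l \sum_m (P m k l + P l k m - P k l m) * y 0 l * y 0 m))).
  rewrite /christoffel_quad /christoffel.
  under eq_bigr => l _ do under eq_bigr => m _ do
    rewrite -mulrA -mulrA mulr_suml mulr_sumr.
  under eq_bigr => l _ do rewrite exchange_big /=.
  rewrite exchange_big /=; apply: eq_bigr => k _.
  rewrite !mulr_sumr; apply: eq_bigr => l _.
  rewrite !mulr_sumr; apply: eq_bigr => m _.
  by rewrite /P; ring.
apply: eq_bigr => k _; congr (_ * _); rewrite PQ.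
under [in RHS]eq_bigr do rewrite PL.
have -> : \sum_m y 0 m * (\sum_l P m k l * y 0 l) =
    \sum_l \sum_m P m k l * y 0 l * y 0 m.
  rewrite exchange_big /=; apply: eq_bigr => m _; rewrite mulr_sumr.
  by apply: eq_bigr => l _; ring.
(* By symmetry of $y^ly^m$ the first two Christoffel terms have equal contractions, which absorbs
   their factor 1/2. *)
have E : \sum_l \sum_m P l k m * y 0 l * y 0 m =
    \sum_l \sum_m P m k l * y 0 l * y 0 m.
  rewrite exchange_big /=; apply: eq_bigr => l _; apply: eq_bigr => m _.
  by ring.
have -> : \sum_l \sum_m (P m k l + P l k m - P k l m) * y 0 l * y 0 m =
    \sum_l \sum_m P m k l * y 0 l * y 0 m + \sum_l \sum_m P l k m * y 0 l * y 0 m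
    - \sum_l \sum_m P k l m * y 0 l * y 0 m.
  rewrite -big_split -sumrB; apply: eq_bigr => l _ /=.
  by rewrite -big_split -sumrB; apply: eq_bigr => m _ /=; ring.
by rewrite E; field.
Qed.

Lemma invmxK_sum (A : 'M[R]_n) (w : 'I_n -> R) i : A \in unitmx ->
  \sum_k A i k * (\sum_j invmx A k j * w j) = w i.
Proof.
move=> uA.
have -> : w i = (A *m (invmx A *m (\col_j w j))) i 0 by rewrite mulKVmx // mxE.
rewrite mxE; apply: eq_bigr => k _; rewrite mxE; congr (_ * _).
by apply: eq_bigr => j _; rewrite mxE.
Qed.

Lemma sum_invmxK (A : 'M[R]_n) (w : 'I_n -> R) i : A \in unitmx ->
  \sum_k invmx A i k * (\sum_j A k j * w j) = w i.
Proof.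
move=> uA.
have -> : w i = (invmx A *m (A *m (\col_j w j))) i 0 by rewrite mulKmx // mxE.
rewrite mxE; apply: eq_bigr => k _; rewrite mxE; congr (_ * _).
by apply: eq_bigr => j _; rewrite mxE.
Qed.

Lemma metric_fun_sym s (A : 'M[R]_n) be g y i j : A^T = A ->
  metric_fun s A be g y i j = metric_fun s A be g y j i.
Proof. by move=> AT; rewrite /metric_fun (A_symE AT i j); ring. Qed.

Lemma raise_contract (A : 'M[R]_n) (w T : 'I_n -> R) : A^T = A -> A \in unitmx ->
  \sum_i raise A w i * (\sum_j A i j * T j) = \sum_j w j * T j.
Proof.
move=> AT uA; under eq_bigr do rewrite mulr_sumr.
rewrite exchange_big; apply: eq_bigr => j _ /=.
rewrite -(invmxK_sum w j uA) mulr_suml; apply: eq_bigr => i _.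
by rewrite (A_symE AT i j) /raise; ring.
Qed.

Lemma raise_norm (A : 'M[R]_n) (be : 'rV[R]_n) c :
  \sum_i \sum_j invmx A i j * be 0 i * be 0 j = - c ^+ 2 ->
  \sum_i raise A (fun j => be 0 j) i * be 0 i = - c ^+ 2.
Proof.
move=> <-; apply: eq_bigr => i _; rewrite /raise mulr_suml.
by apply: eq_bigr => j _; ring.
Qed.

(** Origin of the factor $1-c^2$ in $\nu$: $b^iv_i=b+b\,b^ib_i$. *)
Lemma raise_v_low (A : 'M[R]_n) (be y : 'rV[R]_n) c : A^T = A -> A \in unitmx ->
  \sum_i \sum_j invmx A i j * be 0 i * be 0 j = - c ^+ 2 ->
  \sum_i raise A (fun j => be 0 j) i * v_low A be y i = (1 - c ^+ 2) * b_of be y.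
Proof.
move=> AT uA bb; under eq_bigr do rewrite mulrC.
rewrite sum_v_low; under [X in _ + _ * X]eq_bigr do rewrite mulrC.
rewrite (raise_norm bb); under eq_bigr do rewrite mulrC.
by rewrite raise_contract // -/(b_of be y); ring.
Qed.

(* Pairing a kernel vector [z] with [y] and with [b^i] leaves only
   [nu * (b.z) = 0], after which [A z = 0]. *)
Lemma finsler_metric_unit s (A : 'M[R]_n) (be y : 'rV[R]_n) (g c : R) :
  A^T = A -> A \in unitmx -> in_sector s A be g y ->
  \sum_i \sum_j invmx A i j * be 0 i * be 0 j = - c ^+ 2 ->
  q_of A be y - eps s * (1 - c ^+ 2) * g * b_of be y != 0 ->
  finsler_metric s A be g y \in unitmx.
Proof.
move=> AT uA sec bb nu0; rewrite -row_free_unit; apply: inj_row_free => z zK.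
have [_ gE BE adm] := in_sectorP sec; have B0 := B_fun_neq0 adm.
have q0 : q_of A be y != 0 by case: adm => /gt_eqF ->.
have J0 : J_of s A be g y ^+ 2 != 0 by rewrite gt_eqF // exprn_gt0 // (J_fun_gt0 adm).
have Kz i : \sum_j metric_fun s A be g y i j * z 0 j = 0.
  transitivity ((z *m finsler_metric s A be g y) 0 i); last by rewrite zK mxE.
  rewrite mxE; apply: eq_bigr => j _.
  by rewrite finsler_metric_eq // metric_fun_sym // mulrC.
pose al := \sum_j v_low A be y j * z 0 j; pose bt := \sum_j be 0 j * z 0 j.
pose q := q_of A be y; pose b := b_of be y; pose B := B_of A be g y.
(* Pairing the kernel equation with $y$ gives $y_jz^j=0$ by [metric_fun_y]; dividing by $J^2$
   expresses $v_jz^j$ through $b_jz^j$. *)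
have al_bt : al = (b + g * q) * bt.
  have : \sum_j z 0 j * y_low_fun s A be g y j = 0.
    transitivity (\sum_i y 0 i * \sum_j metric_fun s A be g y i j * z 0 j).
      under eq_bigr => j _ do rewrite -metric_fun_y // mulr_sumr.
      under [RHS]eq_bigr => j _ do rewrite mulr_sumr.
      rewrite exchange_big; apply: eq_bigr => i _; apply: eq_bigr => j _ /=.
      by rewrite metric_fun_sym //; ring.
    by rewrite big1 // => i _; rewrite Kz mulr0.
  under eq_bigr => j _ do rewrite /y_low_fun mulrCA mulrBr.
  rewrite -mulr_sumr => /eqP; rewrite mulf_eq0 (negbTE J0) /= sumrB.
  have -> : \sum_j z 0 j * (g * q_of A be y * be 0 j) = g * q * bt.
    by rewrite mulr_sumr; apply: eq_bigr => j _; rewrite /q; ring.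
  have -> : \sum_j z 0 j * lower A y j = al - b * bt.
    by rewrite /al sum_v_low addrK; apply: eq_bigr => j _; rewrite mulrC.
  by rewrite subr_eq0 => /eqP E; rewrite mulrDl -E; ring.
have Az i : \sum_j A i j * z 0 j = - (g / B * (eps s * b / q * al * v_low A be y i
    - q * (v_low A be y i * bt + be 0 i * al) + q * (b + g * q) * be 0 i * bt)).
  have /eqP := Kz i; rewrite metric_fun_contract mulf_eq0 (negbTE J0) /=.
  by rewrite addr_eq0 => /eqP.
have bt0 : bt = 0.
  pose bu := raise A (fun j => be 0 j).
  have E : bt = - (g / B * (eps s * b / q * al * ((1 - c ^+ 2) * b)
    - q * ((1 - c ^+ 2) * b * bt - c ^+ 2 * al) - q * (b + g * q) * c ^+ 2 * bt)).
    rewrite -[LHS](raise_contract (fun j => be 0 j) _ AT uA).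
    under eq_bigr => i _ do rewrite Az.
    have vE := raise_v_low y AT uA bb; have bE := raise_norm bb.
    transitivity (- (g / B * (eps s * b / q * al * (\sum_i bu i * v_low A be y i)
      - q * ((\sum_i bu i * v_low A be y i) * bt + (\sum_i bu i * be 0 i) * al)
       + q * (b + g * q) * (\sum_i bu i * be 0 i) * bt))); last first.
      by rewrite vE bE -/b; ring.
    transitivity (\sum_i (- (g / B * (eps s * b / q * al - q * bt)) * (bu i * v_low A be y i)
      + (g / B * (q * al - q * (b + g * q) * bt)) * (bu i * be 0 i))).
      by apply: eq_bigr => i _; rewrite -/(bu i); ring.
    by rewrite big_split /= -!mulr_sumr; ring.
  have Bq : B != 0 by rewrite /B BE.
  (* Once $v_jz^j$ is eliminated the $c^2$-terms outside $1-c^2$ cancel, and $\epsilon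
     b(b+gq)-q^2=-\epsilon B$ removes the denominator $B$, leaving
     $b_jz^j\,(1-\epsilon(1-c^2)gb/q)=0$. *)
  have : bt * (q - eps s * (1 - c ^+ 2) * g * b) = 0.
    apply: (mulfI Bq); rewrite mulr0.
    transitivity (q * B * (bt - - (g / B * (eps s * b / q * al * ((1 - c ^+ 2) * b)
      - q * ((1 - c ^+ 2) * b * bt - c ^+ 2 * al) - q * (b + g * q) * c ^+ 2 * bt)))).
      clearbody bt al; rewrite al_bt /B BE /B_fun -/q -/b in B0 *.
      have [e|e] : eps s = 1 :> R \/ eps s = -1 :> R by case: (s); [left|right].
        by rewrite e in B0 *; field; rewrite q0 -[q ^+ 2]mul1r.
      by rewrite e in B0 *; field; rewrite q0.
    by rewrite -E subrr mulr0.
  by move=> /eqP; rewrite mulf_eq0 (negbTE nu0) orbF => /eqP.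
apply/rowP => j; rewrite -[LHS](sum_invmxK (fun j => z 0 j) j uA).
rewrite mxE big1 // => i _; rewrite Az al_bt bt0.
by rewrite !(mulr0, mul0r, subr0, addr0, oppr0).
Qed.

End Spray.

(** * Derivatives in $g$ and $x$, and the spray formula in a chart *)

Section Coordinates.
Context {R : realType} {n : nat}.
Implicit Types (s : sector) (i j k l m : 'I_n).

Lemma is_derive_g s (A : 'M[R]_n) be g y Z k : in_sector s A be g y ->
  log_J2_dg s (q_of A be y) (b_of be y) g Z -> A^T = A ->
  let J2 := J_of s A be g y ^+ 2 in
  dg_y_low s A be g y k =
    J2 * (Z * (lower A y k - g * q_of A be y * be 0 k) - q_of A be y * be 0 k) /\
  Mbar s A be g y * F2 s A be g y =
    J2 * (B_of A be g y * Z - b_of be y * q_of A be y).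
Proof.
move=> sec HZ AT J2; have [_ _ BE adm] := in_sectorP sec.
have B0 := B_fun_neq0 adm.
have dc (a : R) : is_derive g 1 (fun=> a) 0 by exact: is_derive_fun_cst.
have db0 : d_b g (fun=> be) (fun=> y) (fun=> 0) (fun=> 0) = 0.
  by rewrite /d_b big1 // => i _; ring.
have dl0 j : d_lower g (fun=> A) (fun=> y) (fun _ _ => 0) (fun=> 0) j = 0.
  by rewrite /d_lower big1 // => i _; ring.
have dQ0 : d_quad g (fun=> A) (fun=> y) (fun _ _ => 0) (fun=> 0) = 0.
  by rewrite /d_quad big1 // => i _; rewrite dl0; ring.
have d1 := is_derive_id g (1 : R).
split.
  have dy := is_derive_y_low_fun (A := fun=> A) (be := fun=> be) (g := id)
    (y := fun=> y) (fun i j => dc _) (fun i => dc _) d1 (fun i => dc _) sec HZ k.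
  have near_sec := in_sector_near (A := fun=> A) (be := fun=> be) (g := id)
    (y := fun=> y) (fun i j => dc _) (fun i => dc _) d1 (fun i => dc _) sec.
  have E : \forall t \near (0 : R),
      y_low_fun s A be (t *: 1 + g) y k = y_low s A be (t *: 1 + g) y k.
    by near=> t; rewrite y_low_eq //; near: t.
  have [_] := is_derive_line_eq (k := fun t => y_low s A be t y k) E dy.
  rewrite /dg_y_low derive1E => ->.
  by rewrite /d_J2 /d_q /d_gamma db0 dl0 dQ0 -/J2; ring.
have F0 : F2 s A be g y != 0.
  by rewrite /F2 mulf_neq0 ?BE // gt_eqF // exprn_gt0 // (J_fun_gt0 adm).
rewrite /Mbar divfK //.
have [_] := is_derive_F2 (A := fun=> A) (be := fun=> be) (g := id)
    (y := fun=> y) (fun i j => dc _) (fun i => dc _) d1 (fun i => dc _) sec HZ.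
rewrite derive1E => ->.
by rewrite db0 dQ0 -/J2; ring.
Unshelve. all: by end_near.
Qed.

(** Supplies the derivability that [christoffel_quadE] requires of the components. Only existence
    matters, so the derivative is left to be built by [diff]. *)
Lemma derivable_metric_fun s (a : 'rV[R]_n -> 'M[R]_n) (be : 'rV[R]_n -> 'rV[R]_n)
    (g : 'rV[R]_n -> R) (x y v : 'rV[R]_n) k l :
  (forall i j, derivable (fun z => a z i j) x v) ->
  (forall i, derivable (fun z => be z 0 i) x v) ->
  derivable g x v ->
  in_sector s (a x) (be x) (g x) y ->
  derivable (fun z => metric_fun s (a z) (be z) (g z) y k l) x v.
Proof.
move=> da dbe dg sec; have [Z HZ] := ex_log_J2_dg sec.
have [_ _ BE adm] := in_sectorP sec; have B0 := B_fun_neq0 adm.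
rewrite -BE in B0.
have q0 : q_of (a x) (be x) y != 0 by case: adm => /gt_eqF ->.
have Da i j := DeriveDef (da i j) erefl.
have Dbe i := DeriveDef (dbe i) erefl.
have Dg := DeriveDef dg erefl.
have Dy i : is_derive x v (fun=> y 0 i) 0 by exact: is_derive_fun_cst.
have Dyf := Dy : forall i, is_derive x v (fun z => (fun=> y) z 0 i) 0.
have /= DJ := is_derive_J_of_sqr Da Dbe Dg Dyf sec HZ.
have /= Dq := is_derive_q_of Da Dbe Dyf sec.
have /= Db := is_derive_b_of Dbe Dyf.
have /= Dl := is_derive_lower Da Dyf.
have /= Dgam := is_derive_gamma_of Da Dbe Dyf.
have [dB DB] : exists d, is_derive x v (fun z => B_of (a z) (be z) (g z) y) d.
  by eexists; rewrite /B_of; diff.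
have Dv j : exists d, is_derive x v (fun z => v_low (a z) (be z) y j) d.
  by eexists; rewrite /v_low; diff.
have [dvk Dvk] := Dv k; have [dvl Dvl] := Dv l.
suff [d []] : exists d, is_derive x v
  (fun z => metric_fun s (a z) (be z) (g z) y k l) d by [].
by eexists; rewrite /metric_fun; diff.
Qed.

Section Horizontal.
Context (s : sector) (a : 'rV[R]_n -> 'M[R]_n) (be : 'rV[R]_n -> 'rV[R]_n).
Context (g : 'rV[R]_n -> R) (x y : 'rV[R]_n) (c : R).
Context (da : forall m i j, derivable (fun z => a z i j) x (delta_mx 0 m)).
Context (dbe : forall m i, derivable (fun z => be z 0 i) x (delta_mx 0 m)).
Context (dg : forall m, derivable g x (delta_mx 0 m)).
Context (a_sym_near : forall m, \forall t \near (0 : R),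
  (a (t *: delta_mx 0 m + x))^T = a (t *: delta_mx 0 m + x)).
Context (a_unit : a x \in unitmx).
Context (be_norm : \sum_i \sum_j invmx (a x) i j * be x 0 i * be x 0 j = - c ^+ 2).
Context (sec : in_sector s (a x) (be x) (g x) y).

Let q := q_of (a x) (be x) y.
Let b := b_of (be x) y.
Let B := B_of (a x) (be x) (g x) y.
Let J2 := J_of s (a x) (be x) (g x) y ^+ 2.
Let w := lower (a x) y.
Let nu := q - eps s * (1 - c ^+ 2) * g x * b.
(** The $x^m$-derivatives at fixed $y$ of $a_{kj}y^j$, of $a_{kj}y^ky^j$ and of $b$. *)
Let d_w m k := \sum_j partial m (fun z => a z k j) x * y 0 j.
Let d_a m := \sum_k y 0 k * d_w m k.
Let d_be m := \sum_k partial m (fun z => be z 0 k) x * y 0 k.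

Context (a_sym : (a x)^T = a x).
Context (nu0 : nu != 0).

Lemma partial_metric_sym k l m :
  partial k (fun z => a z l m) x = partial k (fun z => a z m l) x.
Proof.
have E : \forall t \near (0 : R),
    a (t *: delta_mx 0 k + x) m l = a (t *: delta_mx 0 k + x) l m.
  by near=> t; apply: A_symE; near: t; exact: a_sym_near.
have [_] := is_derive_line_eq (f := fun z => a z m l) (k := fun z => a z l m) E
  (DeriveDef (@da k m l) erefl).
by rewrite /partial => ->.
Unshelve. all: by end_near.
Qed.

Lemma christoffel_sym i l m : christoffel a x i l m = christoffel a x i m l.
Proof.
rewrite /christoffel; congr (_ * _); apply: eq_bigr => k _.
by rewrite (partial_metric_sym k l m); ring.
Qed.

Lemma f_formE m l : f_form a be x m l =
  partial m (fun z => be z 0 l) x - partial l (fun z => be z 0 m) x.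
Proof.
rewrite /f_form /nabla; under eq_bigr do rewrite christoffel_sym.
by ring.
Qed.

Lemma f_low_sum k : f_low a be x y k = \sum_l f_form a be x k l * y 0 l.
Proof.
rewrite /f_low /f_up; under eq_bigr do rewrite mulr_sumr.
rewrite exchange_big; apply: eq_bigr => l _ /=.
rewrite -(invmxK_sum (fun k => f_form a be x k l) k a_unit) mulr_suml.
by apply: eq_bigr => i _; rewrite /f_mixed /raise mulrA.
Qed.

Lemma f_lowE k :
  f_low a be x y k = d_be k - \sum_m y 0 m * partial m (fun z => be z 0 k) x.
Proof.
rewrite f_low_sum /d_be -sumrB; apply: eq_bigr => l _.
by rewrite f_formE; ring.
Qed.

Lemma f_low_y : \sum_k y 0 k * f_low a be x y k = 0.
Proof.
under eq_bigr do rewrite f_lowE mulrBr mulr_sumr /d_be mulr_sumr.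
rewrite sumrB [X in _ - X]exchange_big /=; apply/eqP; rewrite subr_eq0; apply/eqP.
by apply: eq_bigr => i _; apply: eq_bigr => j _; ring.
Qed.

Lemma lower_f_up : \sum_k w k * f_up a be x y k = 0.
Proof.
rewrite -[RHS]f_low_y /f_low /w /lower; under eq_bigr do rewrite mulr_suml.
under [RHS]eq_bigr do rewrite mulr_sumr.
rewrite exchange_big; apply: eq_bigr => i _; apply: eq_bigr => j _ /=.
by rewrite (A_symE a_sym i j); ring.
Qed.

Lemma be_f_up : \sum_k be x 0 k * f_up a be x y k
  = \sum_j b_up a be x j * f_low a be x y j.
Proof. by rewrite -(raise_contract (fun k => be x 0 k) _ a_sym a_unit). Qed.

(** [christoffel_quadE] applied to $a_{ij}$ itself, with the index lowered. *)
Lemma lower_christoffel_quad k :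
  \sum_i a x k i * christoffel_quad a x y i
  = \sum_m y 0 m * d_w m k - 2^-1 * d_a k.
Proof.
under eq_bigr => i _ do rewrite christoffel_quadE //.
rewrite (invmxK_sum _ k a_unit).
have PW m j : partial m (fun z => lower (a z) y j) x = d_w m j.
  by have [_] := partial_lower y (fun l => @da m j l).
congr (_ - _ * _); first by apply: eq_bigr => m _; rewrite PW.
have d : is_derive x (delta_mx 0 k) (fun z => \sum_l y 0 l * lower (a z) y l)
   (\sum_l (0 * lower (a x) y l + y 0 l * d_w k l)).
  apply: is_derive_fun_sum => l.
  exact: is_derive_fun_mul (is_derive_fun_cst (y 0 l) _ _) (partial_lower y (fun j => @da k l j)).
case: d => _; rewrite /partial => ->; rewrite /d_a.
by apply: eq_bigr => l _; rewrite mul0r add0r.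
Qed.

Let Dbe := \sum_m y 0 m * d_be m.
Let Da := \sum_m y 0 m * d_a m.

Lemma w_christoffel_quad :
  \sum_i w i * christoffel_quad a x y i = 2^-1 * Da.
Proof.
transitivity (\sum_k y 0 k * \sum_i a x k i * christoffel_quad a x y i).
  rewrite /w /lower; under eq_bigr do rewrite mulr_suml.
  under [RHS]eq_bigr do rewrite mulr_sumr.
  rewrite exchange_big; apply: eq_bigr => i _; apply: eq_bigr => j _ /=.
  by rewrite (A_symE a_sym i j); ring.
under eq_bigr do rewrite lower_christoffel_quad mulrBr.
rewrite sumrB.
have -> : \sum_k y 0 k * (2^-1 * d_a k) = 2^-1 * Da.
  by rewrite mulr_sumr; apply: eq_bigr => k _; ring.
have -> : \sum_k y 0 k * (\sum_m y 0 m * d_w m k) = Da.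
  rewrite /Da /d_a; under eq_bigr do rewrite mulr_sumr.
  under [RHS]eq_bigr do rewrite mulr_sumr.
  rewrite exchange_big; apply: eq_bigr => i _; apply: eq_bigr => j _ /=.
  by ring.
by field.
Qed.

Lemma nabla_yy : \sum_j \sum_k y 0 j * y 0 k * nabla a be x j k =
  Dbe - \sum_l be x 0 l * christoffel_quad a x y l.
Proof.
transitivity (\sum_j \sum_k (y 0 j * (partial j (fun z => be z 0 k) x * y 0 k)
   - \sum_l be x 0 l * (christoffel a x l j k * y 0 j * y 0 k))).
  apply: eq_bigr => j _; apply: eq_bigr => k _; rewrite /nabla mulrBr.
  congr (_ - _); first by ring.
  by rewrite mulr_sumr; apply: eq_bigr => l _; ring.
under eq_bigr => j _ do rewrite sumrB -mulr_sumr -/(d_be j).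
rewrite sumrB; congr (_ - _).
under eq_bigr => j _ do rewrite exchange_big /=.
rewrite exchange_big /=; apply: eq_bigr => l _; rewrite /christoffel_quad mulr_sumr.
by apply: eq_bigr => j _; rewrite mulr_sumr.
Qed.

Lemma lower_v_up k : \sum_i a x k i * v_up a be x y i = v_low (a x) (be x) y k.
Proof.
rewrite /v_up; under eq_bigr do rewrite mulrDr.
rewrite big_split /= -/(lower (a x) y k) /v_low; congr (_ + _).
rewrite -(invmxK_sum (fun k => be x 0 k) k a_unit) mulr_sumr.
by apply: eq_bigr => i _; rewrite /b_up /raise; ring.
Qed.

Lemma be_v_up : \sum_i be x 0 i * v_up a be x y i = (1 - c ^+ 2) * b.
Proof.
rewrite -(raise_contract (fun k => be x 0 k) _ a_sym a_unit).
under eq_bigr do rewrite lower_v_up.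
exact: raise_v_low.
Qed.

Lemma v_low_v_up : \sum_i v_low (a x) (be x) y i * v_up a be x y i =
  gamma_of (a x) (be x) y + (1 - c ^+ 2) * b ^+ 2.
Proof.
rewrite /v_up; under eq_bigr do rewrite mulrDr.
rewrite big_split /= sum_v_low -/(b_of _ _) gamma_ofE.
have -> : \sum_i v_low (a x) (be x) y i * (b_of (be x) y * b_up a be x i) =
   b * ((1 - c ^+ 2) * b).
  rewrite -(raise_v_low y a_sym a_unit be_norm) mulr_sumr.
  by apply: eq_bigr => i _; rewrite /b_up -/b; ring.
have -> : \sum_k lower (a x) y k * y 0 k = \sum_k y 0 k * lower (a x) y k.
  by apply: eq_bigr => i _; rewrite mulrC.
by rewrite -/b; ring.
Qed.

(** The left side is $g_{ki}G^i$. On the right [Db], [Da] and [Dq] are the derivatives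
    $y^m\partial_m$, at fixed $y$, of $b$, $a_{ij}y^iy^j$ and $q$. *)
Lemma finsler_christoffel_quad Z k : log_J2_dg s q b (g x) Z ->
  let Db := Dbe in let Dq := eps s * (Da + 2 * b * Db) / (2 * q) in
  let K := fun z => finsler_metric s (a z) (be z) (g z) y in
  \sum_m y 0 m * partial m (fun z => lower (K z) y k) x
    - 2^-1 * partial k (fun z => \sum_l y 0 l * lower (K z) y l) x =
  J2 * (g x / B * (b * Dq - q * Db) + Z * (\sum_m y 0 m * partial m g x))
     * (w k - g x * q * be x 0 k)
  + J2 * (\sum_m y 0 m * d_w m k - (\sum_m y 0 m * partial m g x) * q * be x 0 k
      - g x * Dq * be x 0 k
      - g x * q * (\sum_m y 0 m * partial m (fun z => be z 0 k) x))
  - 2^-1 * (J2 * (d_a k - 2 * g x * q * d_be k + (B * Z - b * q) * partial k g x)).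
Proof.
move=> HZ Db Dq K.
have Da_ m i j := DeriveDef (@da m i j) erefl.
have Dbe_ m i := DeriveDef (@dbe m i) erefl.
have Dg_ m := DeriveDef (@dg m) erefl.
have Dy_ m i : is_derive x (delta_mx 0 m) (fun z => (fun=> y) z 0 i) 0.
  exact: is_derive_fun_cst.
have dbE m : d_b x be (fun=> y) (fun i => 'D_(delta_mx 0 m) (fun z => be z 0 i) x)
    (fun=> 0) = d_be m.
  by apply: eq_bigr => i _; rewrite mulr0 addr0.
have dwE m j : d_lower x a (fun=> y)
    (fun i l => 'D_(delta_mx 0 m) (fun z => a z i l) x) (fun=> 0) j = d_w m j.
  by apply: eq_bigr => i _; rewrite mulr0 addr0.
have daE m : d_quad x a (fun=> y)
    (fun i l => 'D_(delta_mx 0 m) (fun z => a z i l) x) (fun=> 0) = d_a m.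
  by apply: eq_bigr => i _; rewrite mul0r add0r dwE.
(* Euler's relation at all nearby points of the line, so that it may be differentiated in $x$. *)
have near_KE m : \forall t \near (0 : R), let z := t *: delta_mx 0 m + x in
    forall i, y_low_fun s (a z) (be z) (g z) y i = lower (K z) y i.
  have near_sec := in_sector_near (Da_ m) (Dbe_ m) (Dg_ m) (Dy_ m) sec.
  near=> t; pose z := t *: delta_mx 0 m + x; move=> i; rewrite -/z.
  have secz : in_sector s (a z) (be z) (g z) y by rewrite /z; near: t.
  have symz : (a z)^T = a z by rewrite /z; near: t; exact: a_sym_near.
  rewrite -metric_fun_y // /lower; apply: eq_bigr => j _.
  by rewrite /K finsler_metric_eq.
have PL m : partial m (fun z => lower (K z) y k) x =
    J2 * (g x / B * (b * (eps s * (d_a m + 2 * b * d_be m) / (2 * q)) - q * d_be m)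
          + Z * partial m g x) * (w k - g x * q * be x 0 k)
    + J2 * (d_w m k - partial m g x * q * be x 0 k
        - g x * (eps s * (d_a m + 2 * b * d_be m) / (2 * q)) * be x 0 k
        - g x * q * partial m (fun z => be z 0 k) x).
  have E : \forall t \near (0 : R), let z := t *: delta_mx 0 m + x in
      y_low_fun s (a z) (be z) (g z) y k = lower (K z) y k.
    by apply: filterS (near_KE m) => t; apply.
  have [_] := is_derive_line_eq (k := fun z => lower (K z) y k) E
    (is_derive_y_low_fun (Da_ m) (Dbe_ m) (Dg_ m) (Dy_ m) sec HZ k).
  rewrite {1}/partial => ->.
  by rewrite /d_J2 /d_q /d_gamma dbE dwE daE.
have PQ : partial k (fun z => \sum_l y 0 l * lower (K z) y l) x =
    J2 * (d_a k - 2 * g x * q * d_be k + (B * Z - b * q) * partial k g x).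
  have E : \forall t \near (0 : R), let z := t *: delta_mx 0 k + x in
      F2 s (a z) (be z) (g z) y = \sum_l y 0 l * lower (K z) y l.
    apply: filterS (near_KE k) => t H /=; rewrite -y_low_fun_y.
    by apply: eq_bigr => i _; rewrite H.
  have [_] := is_derive_line_eq (k := fun z => \sum_l y 0 l * lower (K z) y l) E
    (is_derive_F2 (Da_ k) (Dbe_ k) (Dg_ k) (Dy_ k) sec HZ).
  by rewrite {1}/partial => ->; rewrite dbE daE.
rewrite PQ; congr (_ - _); under eq_bigr do rewrite PL.
rewrite {}/Dq {}/Db /Da /Dbe.
pose W := w k - g x * q * be x 0 k.
(* The summand is linear in five quantities indexed by [m]; grouping by them pulls every other
   factor out of the sum. *)
transitivity (\sum_m (
    (J2 * (g x / B * b * eps s / (2 * q)) * W - J2 * g x * eps s / (2 * q) * be x 0 k)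
      * (y 0 m * d_a m)
  + (J2 * (g x / B * (b * (eps s * (2 * b) / (2 * q)) - q)) * W
      - J2 * g x * eps s * (2 * b) / (2 * q) * be x 0 k) * (y 0 m * d_be m)
  + (J2 * Z * W - J2 * q * be x 0 k) * (y 0 m * partial m g x)
  + J2 * (y 0 m * d_w m k)
  - J2 * g x * q * (y 0 m * partial m (fun z => be z 0 k) x))).
  by apply: eq_bigr => m _; rewrite -/W; ring.
by rewrite sumrB !big_split /= -!mulr_sumr -/W; ring.
Unshelve. all: by end_near.
Qed.

Lemma spray_coordinates i :
  spray s a be g x y i =
      - (eps s * (g x / nu)
         * (\sum_j \sum_k y 0 j * y 0 k * nabla a be x j k
            - g x * q * \sum_j b_up a be x j * f_low a be x y j)
         * v_up a be x y i)
      + g x * q * f_up a be x y i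
      + E_up s a be g x y i
      + christoffel_quad a x y i.
Proof.
have [Z HZ] := ex_log_J2_dg sec.
have [_ gE BE adm] := in_sectorP sec; have B0 := B_fun_neq0 adm.
have q0 : q != 0 by case: adm => /gt_eqF ->.
pose K := finsler_metric s (a x) (be x) (g x) y.
have K_unit : K \in unitmx := finsler_metric_unit a_sym a_unit sec be_norm nu0.
have [dgyE MF] : (forall k, dg_y_low s (a x) (be x) (g x) y k =
    J2 * (Z * (w k - g x * q * be x 0 k) - q * be x 0 k)) /\
    Mbar s (a x) (be x) (g x) y * F2 s (a x) (be x) (g x) y = J2 * (B * Z - b * q).
  split=> [k|]; first by have [] := is_derive_g k sec HZ a_sym.
  by have [] := is_derive_g i sec HZ a_sym.
set S := \sum_j \sum_k _; set ph := \sum_j _ * f_low _ _ _ _ j.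
pose al := - (eps s * (g x / nu) * (S - g x * q * ph)).
(* The claimed vector without $E^i$; [Ek] below is $g_{ki}E^i$ in closed form. *)
pose T j := al * v_up a be x y j + g x * q * f_up a be x y j + christoffel_quad a x y j.
pose yg := \sum_m y 0 m * partial m g x.
pose Ek k := J2 * (Z * (w k - g x * q * be x 0 k) - q * be x 0 k) * yg
   - 2^-1 * (J2 * (B * Z - b * q)) * partial k g x.
have E_upE : E_up s a be g x y i = \sum_k invmx K i k * Ek k.
  rewrite /E_up -/K -/yg -mulrA mulrA -[_ * _ * F2 _ _ _ _ _]mulrA MF.
  rewrite mulr_sumr -sumrB; apply: eq_bigr => k _.
  by rewrite dgyE /Ek; ring.
(* As $g_{ij}$ is invertible, the formula may be compared after lowering the index, where no inverse
   of $g_{ij}$ occurs. *)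
suff main k : \sum_m y 0 m * partial m (fun z => lower
      (finsler_metric s (a z) (be z) (g z) y) y k) x
    - 2^-1 * partial k (fun z => \sum_l y 0 l * lower
      (finsler_metric s (a z) (be z) (g z) y) y l) x
    = \sum_j K k j * T j + Ek k.
  rewrite /spray christoffel_quadE; last first.
    move=> m k' l'.
    have d := derivable_metric_fun (k := k') (l := l') (@da m) (@dbe m) (@dg m) sec.
    have near_sec := in_sector_near (fun i j => DeriveDef (@da m i j) erefl)
      (fun i => DeriveDef (@dbe m i) erefl) (DeriveDef (@dg m) erefl)
      (fun i => is_derive_fun_cst (y 0 i) _ _ :
         is_derive x (delta_mx 0 m) (fun z => (fun=> y) z 0 i) 0) sec.
    have E : \forall t \near (0 : R),
        metric_fun s (a (t *: delta_mx 0 m + x)) (be (t *: delta_mx 0 m + x))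
          (g (t *: delta_mx 0 m + x)) y k' l' =
        finsler_metric s (a (t *: delta_mx 0 m + x)) (be (t *: delta_mx 0 m + x))
          (g (t *: delta_mx 0 m + x)) y k' l'.
      near=> t; rewrite finsler_metric_eq //; near: t; first exact: a_sym_near.
      exact: near_sec.
    by have [] := is_derive_line_eq
      (k := fun z => finsler_metric s (a z) (be z) (g z) y k' l') E
      (DeriveDef d erefl).
  under eq_bigr => k _ do rewrite main mulrDr.
  rewrite big_split /= -E_upE (sum_invmxK T i K_unit) /T /al.
  by ring.
rewrite (finsler_christoffel_quad k HZ).
have KT : \sum_j K k j * T j = 
   al * (\sum_j metric_fun s (a x) (be x) (g x) y k j * v_up a be x y j)
   + g x * q * (\sum_j metric_fun s (a x) (be x) (g x) y k j * f_up a be x y j)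
   + \sum_j metric_fun s (a x) (be x) (g x) y k j * christoffel_quad a x y j.
  rewrite !mulr_sumr -!big_split; apply: eq_bigr => j _ /=.
  by rewrite /K finsler_metric_eq // /T; ring.
rewrite {}KT !metric_fun_contract lower_v_up be_v_up v_low_v_up.
rewrite !sum_v_low lower_f_up be_f_up -/(f_low a be x y k) -/ph.
rewrite lower_christoffel_quad w_christoffel_quad.
(* Covariant derivatives enter here: the pairing of $b$ with the spray of $a$ is traded for
   $y^jy^h\nabla_jb_h$. *)
have bG : \sum_l be x 0 l * christoffel_quad a x y l = Dbe - S.
  by rewrite /S nabla_yy; ring.
rewrite bG /Ek -/yg -/q -/b -/B -/J2 -/w.
have wE : w k = v_low (a x) (be x) y k - b * be x 0 k.
  by rewrite /v_low -/b -/w addrK.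
rewrite {}wE gE f_lowE /al -/q.
set Wk := \sum_m y 0 m * d_w m k; set Ck := \sum_m y 0 m * partial m _ x.
set v := v_low _ _ _ _; have nu1 := nu0; rewrite /nu /= in nu1 *.
(* The remaining identity holds for arbitrary values of these derivatives, once $\gamma$ and $B$ are
   expressed through $q$, $b$ and $g$. *)
move: (Dbe) (Da) (d_be k) (d_a k) => Db DA dbk dak.
rewrite /B BE /B_fun -/q -/b; rewrite /B_fun -/q -/b in B0.
have [e|e] : eps s = 1 :> R \/ eps s = -1 :> R by case: (s); [left|right].
  rewrite e in nu1 B0 *; rewrite !mul1r in nu1 B0.
  by field; rewrite q0 B0.
by rewrite e in nu1 B0 *; field; rewrite q0 B0.
Unshelve. all: by end_near.
Qed.

End Horizontal.
End Coordinates.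

(** * From the manifold to coordinates *)

Lemma lorentzian_unit (R : realType) (n : nat) (A : 'M[R]_n) :
  lorentzian A -> A \in unitmx.
Proof.
move=> [_ [P _ E]]; have : \det (P *m A *m P^T) != 0.
  rewrite E det_diag; apply/prodf_neq0 => i _; rewrite mxE.
  by case: ifP => _; rewrite ?oppr_eq0 oner_eq0.
rewrite !det_mulmx unitmxE unitfE; apply: contra => /eqP ->.
by rewrite mulr0 mul0r.
Qed.

Lemma smooth_on_derivable (R : realType) (n : nat) (U : set 'rV[R]_n)
    (f : 'rV[R]_n -> R) (x : 'rV[R]_n) (m : 'I_n) :
  smooth_on U f -> U x -> derivable f x (delta_mx 0 m).
Proof. by move=> /(_ 1%N)[_ /(_ m)[d _]] Ux; exact: d. Qed.

Lemma open_near_line (R : realType) (n : nat) (U : set 'rV[R]_n)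
    (x v : 'rV[R]_n) : open U -> U x -> \forall t \near (0 : R), U (t *: v + x).
Proof.
move=> oU Ux; have c : {for 0, continuous (fun t : R => t *: v + x)}.
  by move=> ?; apply: cvgD; [apply: cvgZr_tmp; exact: cvg_id|exact: cvg_cst].
by apply: c; rewrite scale0r add0r; exact: open_nbhs_nbhs.
Qed.

(** $\nu$ is affine in $1-c^2\in[0,1]$ and positive at both ends: $q>0$, and $q-gb>0$ because $B>0$
    means $q(q-gb)>b^2$. *)
Lemma nu_time_neq0 (R : realType) (q b g c : R) : admissible TimeLike q b g ->
  0 < c <= 1 -> q - (1 - c ^+ 2) * g * b != 0.
Proof.
move=> [q0 /=]; rewrite /B_fun /= => B0 /andP[c0 c1].
have k0 : 0 <= 1 - c ^+ 2 by nra.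
have k1 : 1 - c ^+ 2 <= 1 by nra.
have qgb : 0 < q - g * b.
  by rewrite -(pmulr_rgt0 _ q0); have := sqr_ge0 b; lra.
rewrite gt_eqF //; have [gb|gb] := lerP 0 (g * b).
  have : (1 - c ^+ 2) * (g * b) <= g * b by rewrite ler_piMl.
  by lra.
have : 0 <= (1 - c ^+ 2) * - (g * b) by rewrite mulr_ge0 //; lra.
by lra.
Qed.

Theorem mainTheorem1 (R : realType) (N : nat) (M : smoothManifold R N)
    (a : lorentzMetric M) (b : oneForm M) (g c : M -> R)
    (g_smooth : smooth_scalar g) (c_smooth : smooth_scalar c)
    (c_range : forall p : M, 0 < c p <= 1)
    (b_norm : forall u : chart R N M, atlas M u -> forall p : M, cdom u p ->
       \sum_i \sum_j invmx (a u (cmap u p)) i j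
          * b u (cmap u p) 0 i * b u (cmap u p) 0 j = - c p ^+ 2)
    (u : chart R N M) (u_atlas : atlas M u) (p : M) (p_u : cdom u p)
    (s : sector) (y : 'rV[R]_N) :
  let x := cmap u p in
  let A := a u in
  let be := b u in
  let gu := g \o cinv u in
  let gx := g p in
  let q := q_of (A x) (be x) y in
  let nu := q - eps s * (1 - c p ^+ 2) * gx * b_of (be x) y in
  in_sector s (A x) (be x) gx y ->
  (s = SpaceLike -> nu != 0) ->
  forall i : 'I_N,
    spray s A be gu x y i =
      - (eps s * (gx / nu)
         * (\sum_j \sum_k y 0 j * y 0 k * nabla A be x j k
            - gx * q * \sum_j b_up A be x j * f_low A be x y j)
         * v_up A be x y i)
      + gx * q * f_up A be x y i
      + E_up s A be gu x y i
      + christoffel_quad A x y i.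
Proof.
move=> x A be gu gx q nu sec nu0 i.
have x_ran : crange u x by exists p.
have gxE : gu x = gx by rewrite /gu /= cmapK.
have A_lor : forall z, crange u z -> lorentzian (A z) by exact: metric_lorentzian.
have A_sym z : crange u z -> (A z)^T = A z by move=> /A_lor[].
have nu_neq0 : nu != 0.
  case: s @nu sec nu0 => nu sec nu0; last exact: nu0.
  rewrite /nu /= mul1r; have [_ _ _ adm] := in_sectorP sec.
  exact: nu_time_neq0 adm (c_range p).
have dA m j k : derivable (fun z => A z j k) x (delta_mx 0 m).
  by apply: smooth_on_derivable x_ran; exact: metric_smooth.
have dbe m j : derivable (fun z => be z 0 j) x (delta_mx 0 m).
  by apply: smooth_on_derivable x_ran; exact: oneForm_smooth.
have dg m : derivable gu x (delta_mx 0 m).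
  by apply: smooth_on_derivable x_ran; exact: g_smooth.
have A_sym_near m : \forall t \near (0 : R),
    (A (t *: delta_mx 0 m + x))^T = A (t *: delta_mx 0 m + x).
  have near_ran := open_near_line (delta_mx 0 m) (@crange_open _ _ _ u) x_ran.
  by apply: filterS near_ran => t; exact: A_sym.
have A_unit : A x \in unitmx by exact/lorentzian_unit/A_lor.
have := spray_coordinates dA dbe dg A_sym_near A_unit (b_norm u u_atlas p p_u).
by rewrite gxE => /(_ s y sec (A_sym x x_ran) nu_neq0 i).
Qed.
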